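(* Let $n\ge 1$, $T>0$. Assume the following. (1) $K\subseteq\mathbb{R}^n$ is a closed convex cone with vertex at the origin, $D\subset\mathbb{R}^n$ is a non-empty convex domain (open, connected) with $D\neq\mathbb{R}^n$, and either (a) $D$ is bounded and $K=\mathbb{R}^n$, or (b) $D$ is conic with vertex at the origin (i.e. $\lambda x\in D$ for all $x\in D$, $\lambda>0$) and $D-K:=\{\eta-\xi:\eta\in D,\ \xi\in K\}=\mathbb{R}^n$. (2) $f:[0,T]\times\mathbb{R}^n\to\mathbb{R}^n$ is continuous and for a constant $L>0$: $|f(t,x)-f(t,x')|\le L|x-x'|$ and $|f(t,0)|\le L$ for all $t\in[0,T]$, $x,x'\in\mathbb{R}^n$. (3) $g:[0,T]\times\mathbb{R}^n\to[0,\infty)$ and $h:\mathbb{R}^n\to[0,\infty)$ are continuous, and for constants $L,\mu>0$ and $0<\delta\le1$: $0\le g(t,x),h(x)\le L(1+|x|^{\mu+\delta})$ and $|g(t,x)-g(t,x')|,\ |h(x)-h(x')|\le L(1+|x|^\mu\vee|x'|^\mu)|x-x'|^\delta$ for all $t\in[0,T]$, $x,x'\in\mathbb{R}^n$. (4) $\ell:[0,T]\times\mathbb{R}^n\times K\to(0,\infty)$ is continuous, and there are constants $\ell_0,\delta_0>0$, $\beta\in(0,1]$, the same $L,\mu,\delta$ as in (3), and continuous decreasing functions $\alpha_0,\alpha:[0,T]\to(0,\infty)$ such that for all $t,t'\in[0,T]$, $x,x'\in\mathbb{R}^n$, $\xi,\xi'\in K$: $$\ell_0+\alpha_0(t)|\xi|^\beta\le\ell(t,x,\xi)\le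 L+\alpha(t)|\xi|^\beta,$$ $$|\ell(t,x,\xi)-\ell(t,x',\xi)|\le L(1+|x|^\mu\vee|x'|^\mu)|x-x'|^\delta,$$ $$\min\{\ell(t,x,\xi)+\ell(t,x+\xi,\xi'),\ \ell(t,x,\xi')+\ell(t,x+\xi',\xi)\}-\ell(t,x,\xi+\xi')\ge\delta_0,$$ $$\ell(t,x,\xi)-L|t-t'|\le\ell(t',x,\xi)\le\ell(t,x,\xi)\quad\text{if } t\le t'.$$ (5) $$\inf_{\xi\in K,\ x+\xi\in D}\big[h(x+\xi)+\ell(T,x,\xi)\big]<h(x)\qquad\text{for all }x\in\mathbb{R}^n\setminus D.$$ Then the value function $V$ of the terminal-state-constrained impulse control problem described in the context is a viscosity solution of the Hamilton–Jacobi–Bellman quasi-variational inequality $$\begin{cases}\min\big\{V_t(t,x)+\langle V_x(t,x),f(t,x)\rangle+g(t,x),\ \mathbf N[V](t,x)-V(t,x)\big\}=0,&(t,x)\in[0,T)\times\mathbb{R}^n,\\ V(T,x)=h^D(x),&x\in\mathbb{R}^n.\end{cases}$$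
   Context: Impulse control problem. For $t\in[0,T]$, an impulse control on $[t,T]$ is a finite (possibly empty) list of pairs $(\tau_k,\xi_k)_{1\le k\le N}$ with $t\le\tau_1\le\dots\le\tau_N\le T$ and $\xi_k\in K$, identified with $\xi(s)=\sum_{k}\xi_k\mathbf 1_{[\tau_k,T]}(s)$, $s\in[t,T]$ (several impulses at one time are allowed, and zero impulses $\xi_k=0$ are allowed but still incur a cost). $\mathscr K[t,T]$ is the set of all of them. For $(t,x)\in[0,T]\times\mathbb{R}^n$ and $\xi(\cdot)\in\mathscr K[t,T]$, $X(\cdot)=X(\cdot;t,x,\xi(\cdot))$ is the unique (right-continuous) solution of $$X(s)=x+\int_t^sf(r,X(r))\,dr+\xi(s),\qquad s\in[t,T].$$ The set of admissible controls is $\mathscr K^x[t,T]=\{\xi(\cdot)\in\mathscr K[t,T]: X(T;t,x,\xi(\cdot))\in\bar D\}$. The cost functional is $$J(t,x;\xi(\cdot))=\int_t^Tg(s,X(s))\,ds+h(X(T))+\sum_{k}\ell(\tau_k,\tilde X(\tau_k-0),\xi_k),$$ where $\tilde X(\tau_k-0)$ is the state just before the $k$-th impulse is applied: the left limit $X(\tau_k-0)$ (equal to $x$ if $\tau_k=t$) plus the sum of the impulses with smaller index made at the same time $\tau_k$. The value function is $V(t,x)=\inf_{\xi(\cdot)\in\mathscr K^x[t,T]}J(t,x;\xi(\cdot))$, with $\inf\varnothing=+\infty$. Notation: $a\vee b=\max\{a,b\}$. Operators: $\mathbf N[V](t,x)=\min_{\xi\in K}\{V(t,x+\xi)+\ell(t,x,\xi)\}$;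 $\mathbf N^D[h](x)=\min_{\xi\in K,\,x+\xi\in\bar D}\{h(x+\xi)+\ell(T,x,\xi)\}$; $h^D(x)=\min\{h(x),\mathbf N^D[h](x)\}$ for $x\in\bar D$ and $h^D(x)=\mathbf N^D[h](x)$ for $x\in\mathbb{R}^n\setminus\bar D$. Viscosity solutions. A continuous function $V:[0,T]\times\mathbb{R}^n\to\mathbb{R}$ is a viscosity sub-solution of the quasi-variational inequality if $V(T,x)\le h^D(x)$ for all $x\in\mathbb{R}^n$ and, for every $\varphi\in C^1([0,T]\times\mathbb{R}^n)$ such that $V-\varphi$ attains a local maximum at $(t,x)\in[0,T)\times\mathbb{R}^n$, $$\min\{\varphi_t(t,x)+\langle\varphi_x(t,x),f(t,x)\rangle+g(t,x),\ \mathbf N[V](t,x)-V(t,x)\}\ge0.$$ It is a viscosity super-solution if $V(T,x)\ge h^D(x)$ for all $x\in\mathbb{R}^n$ and, for every $\varphi\in C^1([0,T]\times\mathbb{R}^n)$ such that $V-\varphi$ attains a local minimum at $(t,x)\in[0,T)\times\mathbb{R}^n$, the same expression is $\le0$. It is a viscosity solution if it is both (in particular it is continuous). *)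

(* Defs.v *)
From mathcomp Require Import all_boot all_order all_algebra.
From mathcomp Require Import all_classical all_reals all_analysis.

Set Implicit Arguments.
Unset Strict Implicit.
Unset Printing Implicit Defensive.

Import Order.TTheory GRing.Theory Num.Theory.
Import numFieldNormedType.Exports.

Local Open Scope classical_set_scope.
Local Open Scope ring_scope.

Definition dotp (R : realType) (n : nat) (u v : 'rV[R]_n) : R :=
  \sum_(i < n) u 0 i * v 0 i.

(* The library norm `|x| on 'rV[R]_n is the sup norm; |x| in the estimates is
   the Euclidean one. *)
Definition enorm (R : realType) (n : nat) (x : 'rV[R]_n) : R :=
  Num.sqrt (dotp x x).

(* Functions on [0, T] x R^n are total functions of R and 'rV[R]_n whose values
   outside the slab are irrelevant; topological notions are relative to it. *)
Definition slab (R : realType) (n : nat) (T : R) : set (R * 'rV[R]_n) :=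
  [set p | p.1 \in `[0, T]].

Definition continuous_slab (R : realType) (n : nat) (U : topologicalType)
    (T : R) (F : R -> 'rV[R]_n -> U) : Prop :=
  {within @slab R n T, continuous (fun p : R * 'rV[R]_n => F p.1 p.2)}.

Definition is_min (d : Order.disp_t) (U : porderType d) (A : set U) (m : U) :
    Prop :=
  A m /\ lbound A m.

(* Vertex at the origin, the vertex being a point of the cone. *)
Definition closed_convex_cone (R : realType) (n : nat) (K : set 'rV[R]_n) :
    Prop :=
  [/\ closed K, convex_set K, K 0 &
      forall (lam : R) x, 0 < lam -> K x -> K (lam *: x)].

Definition conic (R : realType) (n : nat) (D : set 'rV[R]_n) : Prop :=
  forall (lam : R) x, 0 < lam -> D x -> D (lam *: x).

(* A control is the list of its impulses (tau_k, xi_k), in order of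
   application; impulse times may coincide. *)
Definition impulse_control (R : realType) (n : nat) (T : R) (K : set 'rV[R]_n)
    (t : R) (c : seq (R * 'rV[R]_n)) : Prop :=
  [/\ sorted <=%R (map fst c),
      {in c, forall p, t <= p.1 <= T} &
      {in c, forall p, K p.2}].

Definition impulse_sum (R : realType) (n : nat) (c : seq (R * 'rV[R]_n))
    (s : R) : 'rV[R]_n :=
  \sum_(p <- c | p.1 <= s) p.2.

(* X solves X(s) = x + \int_t^s f(r, X(r)) dr + xi(s) on [t, T]. Integrability
   of r |-> f(r, X(r)) is required explicitly because \int is a total operator;
   right-continuity of X then follows from the equation. *)
Definition is_state (R : realType) (n : nat) (T : R)
    (f : R -> 'rV[R]_n -> 'rV[R]_n) (t : R) (x : 'rV[R]_n)
    (c : seq (R * 'rV[R]_n)) (X : R -> 'rV[R]_n) : Prop :=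
  (forall i, lebesgue_measure.-integrable `[t, T]
               (fun r : R => (f r (X r) 0 i)%:E)) /\
  (forall s : R, s \in `[t, T] ->
     X s = x + \row_i (\int[lebesgue_measure]_(r in `[t, s]) f r (X r) 0 i)
             + impulse_sum c s).

(* The state to which the k-th impulse of c (counted from 0) is applied. *)
Definition pre_impulse_state (R : realType) (n : nat) (t : R) (x : 'rV[R]_n)
    (c : seq (R * 'rV[R]_n)) (X : R -> 'rV[R]_n) (k : nat) : 'rV[R]_n :=
  let tau := (nth (0, 0) c k).1 in
  (if tau == t then x else lim (X s @[s --> tau^'-]))
  + \sum_(p <- take k c | p.1 == tau) p.2.

Definition cost (R : realType) (n : nat) (T : R)
    (g : R -> 'rV[R]_n -> R) (h : 'rV[R]_n -> R)
    (ell : R -> 'rV[R]_n -> 'rV[R]_n -> R) (t : R) (x : 'rV[R]_n)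
    (c : seq (R * 'rV[R]_n)) (X : R -> 'rV[R]_n) : R :=
  \int[lebesgue_measure]_(s in `[t, T]) g s (X s) + h (X T)
  + \sum_(k < size c) ell (nth (0, 0) c k).1 (pre_impulse_state t x c X k)
                          (nth (0, 0) c k).2.

(* ereal_inf set0 = +oo. *)
Definition value (R : realType) (n : nat) (T : R) (K D : set 'rV[R]_n)
    (f : R -> 'rV[R]_n -> 'rV[R]_n) (g : R -> 'rV[R]_n -> R)
    (h : 'rV[R]_n -> R) (ell : R -> 'rV[R]_n -> 'rV[R]_n -> R)
    (t : R) (x : 'rV[R]_n) : \bar R :=
  ereal_inf [set y | exists c X,
    [/\ impulse_control T K t c, is_state T f t x c X, closure D (X T) &
        y = (cost T g h ell t x c X)%:E]].

(* The operators N, N^D and h^D are defined through minima, so they are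
   rendered as relations "m is the value of the operator"; asserting that such
   an m exists includes that the minimum is attained. *)
Definition is_N (R : realType) (n : nat) (K : set 'rV[R]_n)
    (ell : R -> 'rV[R]_n -> 'rV[R]_n -> R) (V : R -> 'rV[R]_n -> R)
    (t : R) (x : 'rV[R]_n) (m : R) : Prop :=
  is_min [set V t (x + xi) + ell t x xi | xi in K] m.

Definition is_ND (R : realType) (n : nat) (T : R) (K D : set 'rV[R]_n)
    (ell : R -> 'rV[R]_n -> 'rV[R]_n -> R) (h : 'rV[R]_n -> R)
    (x : 'rV[R]_n) (m : R) : Prop :=
  is_min [set h (x + xi) + ell T x xi
         | xi in [set xi | K xi /\ closure D (x + xi)]] m.

Definition is_hD (R : realType) (n : nat) (T : R) (K D : set 'rV[R]_n)
    (ell : R -> 'rV[R]_n -> 'rV[R]_n -> R) (h : 'rV[R]_n -> R)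
    (x : 'rV[R]_n) (y : R) : Prop :=
  exists2 m, is_ND T K D ell h x m &
    y = if x \in closure D then Num.min (h x) m else m.

(* phi is C^1 on [0, T] x R^n with phi_t = dt and phi_x = dx; the time
   derivative is one-sided at the endpoints 0 and T. *)
Definition C1_slab (R : realType) (n : nat) (T : R) (phi : R -> 'rV[R]_n -> R)
    (dt : R -> 'rV[R]_n -> R) (dx : R -> 'rV[R]_n -> 'rV[R]_n) : Prop :=
  [/\ continuous_slab T phi, continuous_slab T dt, continuous_slab T dx,
      (forall (t : R) x, t \in `[0, T] ->
         (phi s x - phi t x) / (s - t) @[s --> within `[0, T] (t^')]
           --> dt t x) &
      (forall (t : R) x (i : 'I_n), t \in `[0, T] ->
         is_derive x (delta_mx 0 i) (phi t) (dx t x 0 i))].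

Definition local_max_slab (R : realType) (n : nat) (T : R)
    (F : R -> 'rV[R]_n -> R) (t : R) (x : 'rV[R]_n) : Prop :=
  \forall p \near within (@slab R n T) (nbhs (t, x)), F p.1 p.2 <= F t x.

Definition local_min_slab (R : realType) (n : nat) (T : R)
    (F : R -> 'rV[R]_n -> R) (t : R) (x : 'rV[R]_n) : Prop :=
  \forall p \near within (@slab R n T) (nbhs (t, x)), F t x <= F p.1 p.2.

Definition viscosity_subsolution (R : realType) (n : nat) (T : R)
    (K D : set 'rV[R]_n) (f : R -> 'rV[R]_n -> 'rV[R]_n)
    (g : R -> 'rV[R]_n -> R) (h : 'rV[R]_n -> R)
    (ell : R -> 'rV[R]_n -> 'rV[R]_n -> R) (V : R -> 'rV[R]_n -> R) : Prop :=
  [/\ continuous_slab T V,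
      forall x, exists2 y, is_hD T K D ell h x y & V T x <= y &
      forall phi dt dx, C1_slab T phi dt dx ->
      forall (t : R) x, t \in `[0, T[ ->
        local_max_slab T (fun s y => V s y - phi s y) t x ->
        exists2 m, is_N K ell V t x m &
          Num.min (dt t x + dotp (dx t x) (f t x) + g t x) (m - V t x) >= 0].

Definition viscosity_supersolution (R : realType) (n : nat) (T : R)
    (K D : set 'rV[R]_n) (f : R -> 'rV[R]_n -> 'rV[R]_n)
    (g : R -> 'rV[R]_n -> R) (h : 'rV[R]_n -> R)
    (ell : R -> 'rV[R]_n -> 'rV[R]_n -> R) (V : R -> 'rV[R]_n -> R) : Prop :=
  [/\ continuous_slab T V,
      forall x, exists2 y, is_hD T K D ell h x y & V T x >= y &
      forall phi dt dx, C1_slab T phi dt dx ->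
      forall (t : R) x, t \in `[0, T[ ->
        local_min_slab T (fun s y => V s y - phi s y) t x ->
        exists2 m, is_N K ell V t x m &
          Num.min (dt t x + dotp (dx t x) (f t x) + g t x) (m - V t x) <= 0].

Definition viscosity_solution (R : realType) (n : nat) (T : R)
    (K D : set 'rV[R]_n) (f : R -> 'rV[R]_n -> 'rV[R]_n)
    (g : R -> 'rV[R]_n -> R) (h : 'rV[R]_n -> R)
    (ell : R -> 'rV[R]_n -> 'rV[R]_n -> R) (V : R -> 'rV[R]_n -> R) : Prop :=
  viscosity_subsolution T K D f g h ell V /\
  viscosity_supersolution T K D f g h ell V.

(* Main.v *)
(** The terminal constraint is absorbed into the terminal cost: an admissible control
    may always be completed by one impulse at time T, so V is also the value of the
    unconstrained problem with terminal cost h^D. Hypothesis (5) says that at a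
    non-interior point of D it is strictly better to jump into the open set D, a move
    that survives small perturbations; with compactness this makes h^D uniformly
    continuous on bounded sets.

    Between impulses the state follows the flow Phi of f, so the cost of a control is
    computed by recursion on its list of impulses. Near-optimal controls have a bounded
    number of impulses of bounded size (ell >= ell0, and ell is coercive in xi), and
    carrying a control from (t, x) to a nearby (t', x') changes its cost little; hence V is
    uniformly continuous on bounded sets.

    The viscosity inequalities follow from dynamic programming along Phi. If N[V] > V
    at (t, x), then by semicontinuity of N[V] near-optimal controls have no impulse just
    after t, which gives the super-solution inequality. *)
Require Import Defs.
From mathcomp Require Import all_boot all_order all_algebra.
From mathcomp Require Import all_classical all_reals all_analysis.
From mathcomp Require Import ring lra.
Set Implicit Arguments.
Unset Strict Implicit.
Unset Printing Implicit Defensive.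
Import Order.TTheory GRing.Theory Num.Theory.
Import numFieldNormedType.Exports.
Local Open Scope classical_set_scope.
Local Open Scope ring_scope.

(** * Integrals over segments *)

(** The obstacle is admissibility: carried to a nearby initial point, a control may end outside the
    closure of D. The terminal constraint is therefore removed before continuity is studied; with
    h^D as terminal cost every control is allowed and only costs need comparing. The comparison in
    time is not symmetric. For a later start the early impulses are postponed; for an earlier start
    one waits along the flow at small running cost. Together the two give a modulus of continuity
    that depends only on the radius of a ball. The state equation allows discontinuous X and has
    data only on [0, T]. The fields are extended by freezing time outside [0, T], which gives a flow
    defined for all times, and X is identified with this flow piece by piece, through a continuous
    function that agrees with X before the next impulse. Estimates are carried out in the sup norm;
    the Euclidean hypotheses are converted at the price of a factor n. *)

Section RealIntegral.
Variable R : realType.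
Implicit Types (a b c k : R) (u v : R -> R).
Let mu := @lebesgue_measure R.

Lemma within_integrable u a b :
  {within `[a, b], continuous u} -> mu.-integrable `[a, b] (EFin \o u).
Proof.
by move=> cu; apply: continuous_compact_integrable => //; exact: segment_compact.
Qed.

Lemma continuous_integrable u a b :
  continuous u -> mu.-integrable `[a, b] (EFin \o u).
Proof. by move=> cu; apply: within_integrable; exact: continuous_subspaceT. Qed.

Lemma integrable_subitv u a b c d : a <= c -> d <= b ->
  mu.-integrable `[a, b] (EFin \o u) -> mu.-integrable `[c, d] (EFin \o u).
Proof.
move=> ac db; apply: integrableS => //.
by apply: subset_itv; rewrite bnd_simp.
Qed.

Lemma Rintegral_chasles u a b c : a <= b -> b <= c ->
  mu.-integrable `[a, c] (EFin \o u) ->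
  \int[mu]_(r in `[a, c]) u r =
  \int[mu]_(r in `[a, b]) u r + \int[mu]_(r in `[b, c]) u r.
Proof.
move=> ab bc iu.
have := @Rintegral_itvB R u (BLeft a) (BRight c) b iu.
rewrite !bnd_simp => /(_ ab bc).
rewrite Rintegral_itv_obnd_cbnd; last first.
  apply: integrableS iu => //.
  by apply: subset_itv; rewrite bnd_simp.
by move=> <-; rewrite addrC subrK.
Qed.

Lemma Rintegral_le_bound u v a b :
  mu.-integrable `[a, b] (EFin \o u) -> mu.-integrable `[a, b] (EFin \o v) ->
  (forall r, a <= r <= b -> `|u r| <= v r) ->
  `|\int[mu]_(r in `[a, b]) u r| <= \int[mu]_(r in `[a, b]) v r.
Proof.
move=> iu iv uv; apply: le_trans (le_normr_Rintegral _ iu) _ => //.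
by apply: le_Rintegral => //; exact: integrable_norm iu.
Qed.

Lemma Rintegral_cst_itv a b k : a <= b ->
  \int[mu]_(r in `[a, b]) k = k * (b - a).
Proof.
move=> ab; rewrite Rintegral_cst//= lebesgue_measure_itv/= lte_fin.
by move: ab; rewrite le_eqVlt => /predU1P[->|->//]; rewrite ltxx subrr.
Qed.

Lemma Rintegral_bound u a b k : a <= b ->
  mu.-integrable `[a, b] (EFin \o u) ->
  (forall r, a <= r <= b -> `|u r| <= k) ->
  `|\int[mu]_(r in `[a, b]) u r| <= k * (b - a).
Proof.
move=> ab iu uk; rewrite -Rintegral_cst_itv//.
by apply: Rintegral_le_bound => //; apply: continuous_integrable; exact: cst_continuous.
Qed.

Lemma Rintegral_expR a b k : 0 < k -> a <= b ->
  \int[mu]_(r in `[a, b]) expR (k * (r - a)) = (expR (k * (b - a)) - 1) / k.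
Proof.
move=> k0; rewrite le_eqVlt => /predU1P[->|ab].
  by rewrite set_itv1 Rintegral_set1 subrr mulr0 expR0 subrr mul0r.
have kd (x : R) : is_derive x 1 (fun r => expR (k * (r - a)) / k) (expR (k * (x - a))).
  apply: is_derive_eq.
  rewrite /GRing.scale/=; field; exact: lt0r_neq0.
have kc : continuous (fun r => expR (k * (r - a)) / k).
  by move=> x; apply: differentiable_continuous; apply/derivable1_diffP; case: (kd x).
rewrite /Rintegral (@continuous_FTC2 _ _ (fun r => expR (k * (r - a)) / k))//=.
- by rewrite subrr mulr0 expR0 mulrBl.
- apply: continuous_subspaceT => x.
  apply: continuous_comp; last exact: continuous_expR.
  by apply: cvgM; [exact: cvg_cst|apply: cvgB; [exact: cvg_id|exact: cvg_cst]].
- split.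
  + by move=> x _; case: (kd x).
  + by apply: cvg_at_right_filter; exact: kc.
  + by apply: cvg_at_left_filter; exact: kc.
- by move=> x _; rewrite derive1E; case: (kd x).
Qed.

(** Backward integrals vanish, which later makes the flow stay at its initial point before its
    initial time ([flow_id]). *)
Lemma Rintegral_lt_itv u a b : b <= a -> \int[mu]_(r in `[a, b]) u r = 0.
Proof.
rewrite le_eqVlt => /predU1P[->|ba]; first by rewrite set_itv1 Rintegral_set1.
by rewrite set_itv_ge ?Rintegral_set0// bnd_simp -ltNge.
Qed.

Lemma Rintegral_upper_lip u a b k s s' : mu.-integrable `[a, b] (EFin \o u) ->
  (forall r, a <= r <= b -> `|u r| <= k) -> 0 <= k -> s <= s' <= b ->
  `|\int[mu]_(r in `[a, s']) u r - \int[mu]_(r in `[a, s]) u r| <= k * (s' - s).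
Proof.
move=> iu uk k0 /andP[ss' s'b].
have [s'a|as'] := leP s' a.
  rewrite !Rintegral_lt_itv// ?(le_trans ss')// subrr normr0 mulr_ge0// subr_ge0//.
have [sa|a_s] := leP s a.
  rewrite (Rintegral_lt_itv _ sa) subr0 (le_trans (Rintegral_bound (k := k) _ _ _))//.
  - exact: ltW.
  - exact: integrable_subitv iu.
  - by move=> r /andP[ar rs]; apply: uk; rewrite ar (le_trans rs).
  - by rewrite ler_wpM2l// lerD2l lerN2.
rewrite (Rintegral_chasles (ltW a_s) ss'); last exact: integrable_subitv iu.
rewrite addrC addKr; apply: Rintegral_bound => //.
- by apply: integrable_subitv iu => //; exact: ltW.
- by move=> r /andP[ar rs]; apply: uk; rewrite (le_trans (ltW a_s) ar) (le_trans rs).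
Qed.

Lemma continuous_itv_bound u a b : {within `[a, b], continuous u} ->
  exists2 k, 0 <= k & forall r, a <= r <= b -> `|u r| <= k.
Proof.
move=> cu; have [ab|ba] := leP a b; last first.
  exists 0 => // r /andP[ar rb]; have := le_trans ar rb; by rewrite leNgt ba.
have cn : {within `[a, b], continuous (fun x => `|u x|)}.
  by move=> x; apply: cvg_norm; exact: cu.
have [c _ cmax] := EVT_max ab cn.
by exists `|u c| => // r rab; apply: cmax; rewrite in_itv.
Qed.

Lemma Rintegral_continuous_upper u a : continuous u ->
  continuous (fun s => \int[mu]_(r in `[a, s]) u r).
Proof.
move=> cu s0.
have [k k0 uk] := @continuous_itv_bound u a (s0 + 1) (continuous_subspaceT cu).
apply/cvgrPdist_le => /= e e0.
have k1 : 0 < k + 1 by lra.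
near=> s.
have s_lt : `|s0 - s| <= Num.min 1 (e / (k + 1)).
  by near: s; apply: cvgr_dist_le; rewrite ?lt_min ?ltr01 ?divr_gt0//; exact: cvg_id.
move: s_lt; rewrite le_min => /andP[s1 s2].
have H x y : x <= y <= s0 + 1 ->
  `|\int[mu]_(r in `[a, y]) u r - \int[mu]_(r in `[a, x]) u r| <= (k + 1) * (y - x).
  move=> /andP[xy ys]; apply: (@Rintegral_upper_lip _ _ (s0 + 1)).
  - exact: continuous_integrable.
  - by move=> r /uk; lra.
  - exact: ltW.
  - by rewrite xy.
have He : (k + 1) * `|s0 - s| <= e by rewrite mulrC -ler_pdivlMr.
have [ss|ss] := leP s s0.
- rewrite (le_trans (H _ _ _)) ?ss//=; first lra.
  by rewrite ger0_norm ?subr_ge0// in He.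
- rewrite distrC (le_trans (H _ _ _)) ?(ltW ss)//=.
  + by move: s1; rewrite ler_norml => /andP[]; lra.
  + by rewrite ltr0_norm ?subr_lt0// opprB in He.
Unshelve. all: by end_near. Qed.

End RealIntegral.

(** * Coordinatewise integrals of vector functions, estimated in the sup norm *)

Section VectorIntegral.
Variables (R : realType) (n : nat).
Implicit Types (a b c k : R) (F G : R -> 'rV[R]_n) (x : 'rV[R]_n).
Let mu := @lebesgue_measure R.

Lemma rV_norm_leP x k : 0 <= k -> reflect (forall i, `|x 0 i| <= k) (`|x| <= k).
Proof.
move=> k0; rewrite [in X in reflect _ X]/Num.Def.normr/= mx_normrE.
apply: (iffP (bigmax_leP _ _ _ _)) => [[_ xk] i|xk]; first exact: (xk (0, i)).
by split => // -[i j] _ /=; rewrite ord1.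
Qed.

Lemma rV_coord_le x i : `|x 0 i| <= `|x|.
Proof. exact/rV_norm_leP. Qed.

Definition vint a b F : 'rV[R]_n := \row_i \int[mu]_(r in `[a, b]) F r 0 i.

Definition vintegrable a b F :=
  forall i, mu.-integrable `[a, b] (EFin \o fun r => F r 0 i).

Lemma continuous_coord F i : continuous F -> continuous (fun r => F r 0 i).
Proof.
move=> cF r; apply: (@continuous_comp _ _ _ F (fun M : 'rV[R]_n => M 0 i)).
  exact: cF.
exact: coord_continuous.
Qed.

Lemma continuous_rV (f : R -> 'rV[R]_n) :
  (forall i, continuous (fun r => f r 0 i)) -> continuous f.
Proof.
move=> cf r; apply/cvgrPdist_le => /= e e0.
have H : \forall s \near r, forall i : 'I_n, `|f r 0 i - f s 0 i| <= e.
  apply: (@filter_forall _ _ (fun (i : 'I_n) s => `|f r 0 i - f s 0 i| <= e) (nbhs r)).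
  by move=> i; have /cvgrPdist_le := cf i r; apply.
near=> s; apply/rV_norm_leP; first exact: ltW.
by move=> i; rewrite !mxE; move: i; near: s.
Unshelve. all: by end_near. Qed.

Lemma continuous_vintegrable F a b : continuous F -> vintegrable a b F.
Proof. by move=> cF i; apply: continuous_integrable; exact: continuous_coord. Qed.

Lemma eq_vint a b F G : (forall r, a <= r <= b -> F r = G r) ->
  vint a b F = vint a b G.
Proof.
move=> FG; apply/rowP => i; rewrite !mxE; apply: eq_Rintegral => r.
by rewrite inE/= in_itv/= => /FG ->.
Qed.

Lemma vintB a b F G : vintegrable a b F -> vintegrable a b G ->
  vint a b (fun r => F r - G r) = vint a b F - vint a b G.
Proof.
move=> iF iG; apply/rowP => i; rewrite !mxE -RintegralB//.
by apply: eq_Rintegral => r _; rewrite !mxE.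
Qed.

Lemma vint_chasles F a b c : a <= b -> b <= c -> vintegrable a c F ->
  vint a c F = vint a b F + vint b c F.
Proof.
by move=> ab bc iF; apply/rowP => i; rewrite !mxE; exact: Rintegral_chasles.
Qed.

Lemma vint0 F a b : b <= a -> vint a b F = 0.
Proof. by move=> ba; apply/rowP => i; rewrite !mxE Rintegral_lt_itv. Qed.

Lemma vint_le_bound F (v : R -> R) a b :
  vintegrable a b F -> mu.-integrable `[a, b] (EFin \o v) ->
  (forall r, a <= r <= b -> `|F r| <= v r) ->
  `|vint a b F| <= \int[mu]_(r in `[a, b]) v r.
Proof.
move=> iF iv Fv; apply/rV_norm_leP.
  apply: Rintegral_ge0 => r /=; rewrite in_itv/= => /Fv; exact: le_trans.
move=> i; rewrite mxE; apply: Rintegral_le_bound => // r /Fv.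
exact: le_trans (rV_coord_le _ _).
Qed.

Lemma vint_bound F a b k : a <= b -> vintegrable a b F ->
  (forall r, a <= r <= b -> `|F r| <= k) -> `|vint a b F| <= k * (b - a).
Proof.
move=> ab iF Fk; rewrite -Rintegral_cst_itv//; apply: vint_le_bound => //.
by apply: continuous_integrable; exact: cst_continuous.
Qed.

Lemma vint_cst a b x : a <= b -> vint a b (fun=> x) = (b - a) *: x.
Proof.
by move=> ab; apply/rowP => i; rewrite !mxE Rintegral_cst_itv// mulrC.
Qed.

Lemma vint_continuous_upper F a : continuous F -> continuous (fun s => vint a s F).
Proof.
move=> cF; apply: continuous_rV => i.
rewrite (_ : (fun r => _) = fun s => \int[mu]_(r in `[a, s]) F r 0 i).
  by apply: Rintegral_continuous_upper; exact: continuous_coord.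
by apply/funext => s; rewrite mxE.
Qed.

(* The weight exp (2 k (s - a)) makes integration against a k-Lipschitz field a
   contraction of ratio 1/2 on any interval. *)
Lemma vint_expR_bound F a b k m : 0 < k -> 0 <= m -> a <= b ->
  vintegrable a b F ->
  (forall r, a <= r <= b -> `|F r| <= k * (m * expR (2 * k * (r - a)))) ->
  `|vint a b F| <= m / 2 * (expR (2 * k * (b - a)) - 1).
Proof.
move=> k0 m0 ab iF Fm.
have ce : continuous (fun r => expR (2 * k * (r - a))).
  move=> x; apply: continuous_comp; last exact: continuous_expR.
  by apply: cvgM; [exact: cvg_cst|apply: cvgB; [exact: cvg_id|exact: cvg_cst]].
apply: le_trans (vint_le_bound (v := fun r => k * m * expR (2 * k * (r - a))) _ _ _) _ => //.
- apply: continuous_integrable => x; apply: cvgM; [exact: cvg_cst|exact: ce].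
- by move=> r /Fm; rewrite mulrA.
- rewrite RintegralZl//; last exact: continuous_integrable.
  rewrite Rintegral_expR ?mulr_gt0//.
  rewrite le_eqVlt; apply/orP; left; apply/eqP; field.
  exact: lt0r_neq0.
Qed.

End VectorIntegral.

(** * The flow of a Lipschitz field *)
Section Flow.
Variables (R : realType) (n : nat) (F : R -> 'rV[R]_n -> 'rV[R]_n) (C : R).
Hypotheses (C0 : 0 < C)
  (cF : continuous (fun p : R * 'rV[R]_n => F p.1 p.2))
  (lipF : forall t x y, `|F t x - F t y| <= C * `|x - y|)
  (F0 : forall t, `|F t 0| <= C).
Implicit Types (t s : R) (x y : 'rV[R]_n) (k : nat).

Lemma continuous_along (U : topologicalType) (G : R -> 'rV[R]_n -> U)
    (y : R -> 'rV[R]_n) :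
  continuous (fun p : R * 'rV[R]_n => G p.1 p.2) -> continuous y ->
  continuous (fun r => G r (y r)).
Proof.
move=> cG cy r.
have h : (q, y q) @[q --> r] --> (r, y r) by exact: (cvg_pair (@cvg_id _ _) (cy r)).
exact: (@continuous_comp _ _ _ (fun r => (r, y r)) (fun p => G p.1 p.2) r h (cG _)).
Qed.

Lemma field_growth t x : `|F t x| <= C * (1 + `|x|).
Proof.
have := lipF t x 0; rewrite subr0 => H.
rewrite -[F t x](subrK (F t 0)) (le_trans (ler_normD _ _))// mulrDr mulr1 addrC.
by rewrite lerD.
Qed.

Local Notation E t s := (expR (2 * C * (s - t))).

Lemma expw_gt0 t s : 0 < E t s. Proof. exact: expR_gt0. Qed.

Lemma expw_ge1 t s : t <= s -> 1 <= E t s.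
Proof. by move=> ts; rewrite -expR0 ler_expR !mulr_ge0 ?subr_ge0// ltW. Qed.

Fixpoint picard t x k : R -> 'rV[R]_n :=
  if k is k'.+1 then fun s => x + vint t s (fun r => F r (picard t x k' r))
  else fun=> x.

Lemma picard_continuous t x k : continuous (picard t x k).
Proof.
elim: k => [|k ih] /=; first exact: cst_continuous.
move=> s; apply: cvgD; first exact: cvg_cst.
by apply: vint_continuous_upper; exact: continuous_along.
Qed.

Lemma vint_lip_bound t s m (y z : R -> 'rV[R]_n) : t <= s -> 0 <= m ->
  continuous y -> continuous z ->
  (forall r, t <= r <= s -> `|y r - z r| <= m * E t r) ->
  `|vint t s (fun r => F r (y r)) - vint t s (fun r => F r (z r))|
    <= m / 2 * (E t s - 1).
Proof.
move=> ts m0 cy cz yz.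
rewrite -vintB; [|apply: continuous_vintegrable; exact: continuous_along..].
apply: (@vint_expR_bound _ _ _ _ _ C) => //.
  move=> i; apply: continuous_integrable; apply: continuous_coord => r.
  by apply: cvgB; apply: (continuous_along cF).
by move=> r /yz rs; rewrite (le_trans (lipF _ _ _))// ler_wpM2l// ltW.
Qed.

(** The weight [E t s] turns every Picard step into a halving, so the iterates converge
    geometrically on intervals of any length and no gluing of short time steps is required. *)
Lemma picard_step t x k s :
  `|picard t x k.+1 s - picard t x k s| <= (1 + `|x|) * 2^-1 ^+ k * E t s.
Proof.
have A0 : 0 <= 1 + `|x| by rewrite addr_ge0.
have [ts|st] := leP t s; last first.
  have -> j : picard t x j s = x by case: j => //= j; rewrite vint0 ?addr0// ltW.
  have -> : picard t x k s = x by case: k => //= j; rewrite vint0 ?addr0// ltW.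
  by rewrite subrr normr0 !mulr_ge0// ?exprn_ge0// expR_ge0.
elim: k s ts => [|k ih] s ts.
  rewrite /= addrC addKr expr0 mulr1.
  rewrite (le_trans (vint_bound (k := C * (1 + `|x|)) ts _ _))//.
  - by apply: continuous_vintegrable; apply: continuous_along => //; exact: cst_continuous.
  - by move=> r _; exact: field_growth.
  - rewrite (_ : C * _ * _ = (1 + `|x|) * (C * (s - t))); last by ring.
    rewrite ler_wpM2l//.
    have := expR_ge1Dx (2 * C * (s - t)).
    have : 0 <= C * (s - t) by rewrite mulr_ge0 ?subr_ge0// ltW.
    lra.
rewrite [picard t x k.+2]/= [in X in _ - X]/= opprD addrACA subrr add0r.
apply: le_trans (@vint_lip_bound t s ((1 + `|x|) * 2^-1 ^+ k)
  (picard t x k.+1) (picard t x k) ts _ _ _ _) _.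
- by rewrite mulr_ge0// exprn_ge0.
- exact: picard_continuous.
- exact: picard_continuous.
- by move=> r /andP[tr _]; exact: ih.
- rewrite exprSr mulrA ler_wpM2l ?mulr_ge0 ?exprn_ge0//; lra.
Qed.

Lemma picard_dist t x k m s :
  `|picard t x (k + m) s - picard t x k s| <= 2 * (1 + `|x|) * E t s * 2^-1 ^+ k.
Proof.
have A0 : 0 <= (1 + `|x|) * E t s by rewrite mulr_ge0 ?addr_ge0// expR_ge0.
(* The exact partial sum of the geometric series is kept so that the induction on [m] closes. *)
have: `|picard t x (k + m) s - picard t x k s| <=
   2 * (1 + `|x|) * E t s * (2^-1 ^+ k - 2^-1 ^+ (k + m)).
  elim: m => [|m ih]; first by rewrite addn0 !subrr normr0 mulr0.
  rewrite (le_trans (ler_distD (picard t x (k + m) s) _ _))//.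
  rewrite addnS; apply: le_trans (lerD (picard_step _ _ _ _) ih) _.
  rewrite exprS; lra.
move/le_trans; apply; rewrite ler_wpM2l -?mulrA ?mulr_ge0 ?addr_ge0 ?expR_ge0//.
by rewrite lerBlDr lerDl exprn_ge0.
Qed.

Lemma geometric_half_small (B e : R) : 0 <= B -> 0 < e ->
  exists k, B * 2^-1 ^+ k <= e.
Proof.
move=> B0 e0.
have : (fun k => B * (2^-1 : R) ^+ k) @ \oo --> B * 0.
  by apply: cvgM; [exact: cvg_cst|apply: cvg_expr; rewrite ger0_norm//; lra].
rewrite mulr0 => /cvgrPdist_le /(_ _ e0) [k _ /(_ k (leqnn _))].
by rewrite sub0r normrN => /(le_trans (ler_norm _)); exists k.
Qed.

Definition flow t x s := lim (picard t x k s @[k --> \oo]).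

Lemma picard_cvg t x s : picard t x k s @[k --> \oo] --> flow t x s.
Proof.
apply/cauchy_cvgP; apply: cauchy_exP => e e0.
have [k ke] := @geometric_half_small (2 * (1 + `|x|) * E t s) (e / 2)
  ltac:(by rewrite !mulr_ge0 ?addr_ge0 ?expR_ge0) ltac:(by rewrite divr_gt0).
exists (picard t x k s); exists k => // m /= km.
rewrite -ball_normE/= distrC -(subnKC km).
rewrite (le_lt_trans (picard_dist _ _ _ _ _))// (le_lt_trans ke)//; lra.
Qed.

Lemma picard_flow t x k s :
  `|flow t x s - picard t x k s| <= 2 * (1 + `|x|) * E t s * 2^-1 ^+ k.
Proof.
have H : `|picard t x m s - picard t x k s| @[m --> \oo] -->
         `|flow t x s - picard t x k s|.
  by apply: cvg_norm; apply: cvgB; [exact: picard_cvg|exact: cvg_cst].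
apply: (ler_cvg_to H (cvg_cst _)).
by exists k => // m /= km; rewrite -(subnKC km); exact: picard_dist.
Qed.

(** A locally uniform limit of continuous iterates: the bound of [picard_flow] is monotone in time,
    so one index [k] serves all times up to [s0 + 1]. *)
Lemma flow_continuous t x : continuous (flow t x).
Proof.
move=> s0; apply/cvgrPdist_le => /= e e0.
have B0 : 0 <= 2 * (1 + `|x|) * E t (s0 + 1) by rewrite !mulr_ge0 ?addr_ge0 ?expR_ge0.
have [k ke] := @geometric_half_small _ (e / 3) B0 ltac:(by rewrite divr_gt0).
have H s : s <= s0 + 1 -> `|flow t x s - picard t x k s| <= e / 3.
  move=> ss0; apply: le_trans (picard_flow _ _ _ _) (le_trans _ ke).
  rewrite ler_wpM2r ?exprn_ge0// ler_wpM2l ?mulr_ge0 ?addr_ge0//.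
  by rewrite ler_expR ler_wpM2l ?mulr_ge0 ?lerD2r// ltW.
near=> s.
have s1 : s <= s0 + 1.
  have : `|s0 - s| <= 1 by near: s; apply: cvgr_dist_le => //; exact: cvg_id.
  by rewrite ler_norml => /andP[]; lra.
have p1 : `|picard t x k s0 - picard t x k s| <= e / 3.
  near: s; apply: cvgr_dist_le; first exact: picard_continuous.
  by rewrite divr_gt0.
have := H _ s1; rewrite distrC => Hs.
have Hs0 := H s0 ltac:(by rewrite lerDl).
rewrite (le_trans (ler_distD (picard t x k s0) _ _))//.
rewrite (_ : e = e / 3 + (e / 3 + e / 3)); last by field.
by rewrite lerD// (le_trans (ler_distD (picard t x k s) _ _))// lerD.
Unshelve. all: by end_near. Qed.

(** The limit is taken in the Picard recursion: both sides are close to the iterate of index [k.+1],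
    the right one because the field is Lipschitz and iterate [k] is close to the flow. *)
Lemma flow_eq t x s : flow t x s = x + vint t s (fun r => F r (flow t x r)).
Proof.
have [ts|st] := leP t s; last first.
  rewrite vint0 ?addr0; last exact: ltW.
  have H : (fun k => picard t x k s) = fun=> x.
    by apply/funext => -[//|j] /=; rewrite vint0 ?addr0// ltW.
  by rewrite /flow H lim_cst.
apply/eqP; rewrite -subr_eq0 -normr_eq0 eq_le normr_ge0 andbT.
apply/ler_addgt0Pr => e e0; rewrite add0r.
have B0 : 0 <= 2 * (1 + `|x|) * E t s by rewrite !mulr_ge0 ?addr_ge0 ?expR_ge0.
have [k ke] := @geometric_half_small _ (e / 2) B0 ltac:(by rewrite divr_gt0).
rewrite -(subrK (picard t x k.+1 s) (flow t x s)) -addrA (le_trans (ler_normD _ _))//.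
rewrite [e]splitr lerD//.
  rewrite (le_trans (picard_flow _ _ _ _))// (le_trans _ ke)// ler_wpM2l// exprS.
  have : 0 <= 2^-1 ^+ k :> R by rewrite exprn_ge0.
  lra.
rewrite /= opprD addrACA subrr add0r.
apply: le_trans (@vint_lip_bound t s (2 * (1 + `|x|) * 2^-1 ^+ k)
  (picard t x k) (flow t x) ts _ _ _ _) _.
- by rewrite !mulr_ge0 ?addr_ge0 ?exprn_ge0.
- exact: picard_continuous.
- exact: flow_continuous.
- by move=> r _; rewrite distrC mulrAC; exact: picard_flow.
- apply: le_trans ke.
  have : 0 <= (1 + `|x|) * 2^-1 ^+ k by rewrite mulr_ge0 ?addr_ge0 ?exprn_ge0.
  set q := (1 + `|x|) * _ => q0.
  rewrite (_ : _ / 2 = q); last by rewrite /q; field.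
  rewrite (_ : _ * 2^-1 ^+ k = 2 * q * E t s); last by rewrite /q; ring.
  have := mulr_ge0 q0 (expR_ge0 (2 * C * (s - t))); lra.
Qed.

(** The quotient of [|y - z|] by the weight has a maximum [m], at some [c]. There the contraction
    estimate gives m E <= a + m (E - 1) / 2, and since E >= 1 this forces m <= 2 a. *)
Lemma gronwall t b a (y z : R -> 'rV[R]_n) : 0 <= a -> continuous y -> continuous z ->
  (forall s, t <= s <= b -> `|y s - z s| <=
     a + `|vint t s (fun r => F r (y r)) - vint t s (fun r => F r (z r))|) ->
  forall s, t <= s <= b -> `|y s - z s| <= 2 * a * E t s.
Proof.
move=> a0 cy cz H s /andP[ts sb].
have tb := le_trans ts sb.
have cw : {within `[t, b], continuous (fun r => `|y r - z r| / E t r)}.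
  apply: continuous_subspaceT => r; apply: cvgM.
    by apply: cvg_norm; apply: cvgB; [exact: cy|exact: cz].
  apply: cvgV; first exact: lt0r_neq0 (expw_gt0 _ _).
  apply: (@continuous_comp _ _ _ (fun r => 2 * C * (r - t)) expR); last exact: continuous_expR.
  by apply: cvgM; [exact: cvg_cst|apply: cvgB; [exact: cvg_id|exact: cvg_cst]].
have [c /[!in_itv]/=/andP[tc cb] cmax] := EVT_max tb cw.
set m := `|y c - z c| / E t c in cmax.
have m0 : 0 <= m by rewrite /m divr_ge0 ?expR_ge0.
have yzm r : t <= r <= b -> `|y r - z r| <= m * E t r.
  by move=> rb; rewrite -ler_pdivrMr ?expw_gt0//; apply: cmax; rewrite in_itv.
have := H c; rewrite tc cb => /(_ isT) Hc.
have Hv := @vint_lip_bound t c m y z tc m0 cy cz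
   ltac:(by move=> r /andP[tr rc]; apply: yzm; rewrite tr (le_trans rc)).
have Hm : `|y c - z c| = m * E t c by rewrite /m divfK// lt0r_neq0 ?expw_gt0.
rewrite (le_trans (yzm s _)) ?ts// ler_wpM2r ?expR_ge0//.
have E1 := expw_ge1 tc; rewrite Hm in Hc.
have {Hc}Hc : m * E t c <= a + m / 2 * (E t c - 1) by rewrite (le_trans Hc)// lerD2l.
have : m * 1 <= m * E t c by rewrite ler_wpM2l.
by move: Hc; lra.
Qed.

Lemma flow_unique t b x (y : R -> 'rV[R]_n) : continuous y ->
  (forall s, t <= s <= b -> y s = x + vint t s (fun r => F r (y r))) ->
  forall s, t <= s <= b -> y s = flow t x s.
Proof.
move=> cy Hy s sb; apply/eqP; rewrite -subr_eq0 -normr_eq0 eq_le normr_ge0 andbT.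
have := @gronwall t b 0 y (flow t x) (lexx _) cy (@flow_continuous t x) _ s sb.
rewrite mulr0 mul0r; apply=> r rb.
by rewrite Hy// flow_eq opprD addrACA subrr !add0r.
Qed.

Lemma flow_id t x s : s <= t -> flow t x s = x.
Proof. by move=> st; rewrite flow_eq vint0// addr0. Qed.

Lemma flow_semigroup t x s r : t <= s -> s <= r -> flow s (flow t x s) r = flow t x r.
Proof.
move=> ts sr; symmetry; apply: (@flow_unique s r) => //; last by rewrite sr lexx.
  exact: flow_continuous.
move=> q /andP[sq _]; rewrite flow_eq (@vint_chasles _ _ _ t s q)//.
  by rewrite addrA -flow_eq.
by apply: continuous_vintegrable; apply: continuous_along => //; exact: flow_continuous.
Qed.

Lemma flow_lip t x y s : t <= s -> `|flow t x s - flow t y s| <= 2 * `|x - y| * E t s.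
Proof.
move=> ts; apply: (@gronwall t s); rewrite ?ts ?lexx//; try exact: flow_continuous.
move=> r _; rewrite [in X in X <= _]flow_eq [in X in _ - X]flow_eq opprD addrACA.
exact: ler_normD.
Qed.

(** Gronwall against the constant path [x], whose defect in the integral equation is the integral of
    [F r x]. *)
Lemma flow_growth t x s : t <= s ->
  `|flow t x s - x| <= 2 * (C * (1 + `|x|) * (s - t)) * E t s.
Proof.
move=> ts; apply: (@gronwall t s _ (flow t x) (fun=> x)); rewrite ?ts ?lexx//.
- by rewrite mulr_ge0 ?subr_ge0// mulr_ge0 ?addr_ge0// ltW.
- exact: flow_continuous.
- exact: cst_continuous.
move=> r /andP[tr rs]; rewrite [in X in X <= _]flow_eq addrC addKr.
set u := vint t r _; set v := vint t r _.
rewrite -[u in X in X <= _](subrK v) (le_trans (ler_normD _ _))// addrC lerD2r.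
rewrite /v (le_trans (vint_bound (k := C * (1 + `|x|)) _ _ _))//.
- apply: continuous_vintegrable; apply: continuous_along => //; exact: cst_continuous.
- by move=> q _; exact: field_growth.
- by rewrite ler_wpM2l ?lerD2r// mulr_ge0 ?addr_ge0// ltW.
Qed.

Lemma flow_right_derivative t x e : 0 < e ->
  exists2 eta, 0 < eta & forall s, t <= s <= t + eta ->
    `|flow t x s - x - (s - t) *: F t x| <= e * (s - t).
Proof.
move=> e0.
have cf : continuous (fun r => F r (flow t x r)).
  by apply: continuous_along => //; exact: flow_continuous.
have := cf t; rewrite /continuous_at flow_id// => /cvgrPdist_le/(_ _ e0).
move=> /nbhs_ballP[eta /= eta0 H].
exists (eta / 2); first by rewrite divr_gt0.
move=> s /andP[ts se].
rewrite [in X in X <= _]flow_eq -vint_cst// (addrC x) addrK.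
rewrite -vintB; [|exact: continuous_vintegrable|].
  apply: vint_bound => //.
    by apply: continuous_vintegrable => r; apply: cvgB; [exact: cf|exact: cvg_cst].
  move=> r /andP[tr rs]; rewrite distrC; apply: H.
  rewrite -ball_normE/= ler0_norm; lra.
by apply: continuous_vintegrable; exact: cst_continuous.
Qed.

End Flow.

(** * The terminal value h^D *)
Section CoerciveMinimum.
Variables (R : realType) (n : nat).

Lemma continuous_addl (x : 'rV[R]_n) : continuous (fun z : 'rV[R]_n => x + z).
Proof.
by move=> z; exact: (@cvgD _ _ _ (nbhs z) _ (fun=> x) id x z (cvg_cst x) cvg_id).
Qed.

Lemma continuous_addr (x : 'rV[R]_n) : continuous (fun z : 'rV[R]_n => z + x).
Proof.
by rewrite (_ : (fun z => _) = +%R x); [exact: continuous_addl|apply/funext => z; rewrite addrC].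
Qed.

Lemma closed_norm_le M : closed [set x : 'rV[R]_n | `|x| <= M].
Proof.
apply: (@preimage_closed _ _ (fun x : 'rV[R]_n => `|x|) [set r : R | r <= M]).
  by move=> x _; exact: norm_continuous.
exact: closed_le.
Qed.

Lemma compact_norm_le M : compact [set x : 'rV[R]_n | `|x| <= M].
Proof.
apply: bounded_closed_compact; last exact: closed_norm_le.
by exists M; split => [|r Mr x xM]; [exact: num_real|exact: le_trans (ltW Mr)].
Qed.

Lemma coercive_min (S : set 'rV[R]_n) (f : 'rV[R]_n -> R) :
  S !=set0 -> closed S -> {within S, continuous f} ->
  (forall B, exists M, forall x, S x -> f x <= B -> `|x| <= M) ->
  exists2 x, S x & forall y, S y -> f x <= f y.
Proof.
move=> [x0 Sx0] cS cf coer; have [M HM] := coer (f x0).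
pose A := S `&` [set x | `|x| <= M].
have A0 : A !=set0 by exists x0; split => //; exact: HM.
have cA : compact A.
  by rewrite /A setIC; apply: compact_closedI => //; exact: compact_norm_le.
have [x] := EVT_min_rV A0 cA (continuous_subspaceW (@subIsetl _ _ _) cf).
rewrite inE => -[Sx xM] xmin; exists x => // y Sy.
have [yM|yM] := leP `|y| M; first by apply: xmin; rewrite inE; split.
have x0A : x0 \in A by rewrite inE; split => //; exact: HM.
rewrite (le_trans (xmin _ x0A))// leNgt; apply/negP => /ltW yx0.
by move: yM; rewrite ltNge => /negP; apply; exact: HM.
Qed.

End CoerciveMinimum.

Section TerminalValue.
Variables (R : realType) (n : nat) (K D : set 'rV[R]_n) (h : 'rV[R]_n -> R)
  (l : 'rV[R]_n -> 'rV[R]_n -> R).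
Hypotheses (K_closed : closed K) (KD : forall x y, K x -> K y -> K (x + y))
  (D_open : open D) (D_reach : forall x, exists2 z, K z & D (x + z))
  (h_cont : continuous h) (h_ge0 : forall x, 0 <= h x)
  (l_ge0 : forall x z, K z -> 0 <= l x z)
  (l_coercive : forall B, exists M, forall x z, K z -> l x z <= B -> `|z| <= M)
  (l_unif : forall M e, 0 < e -> exists2 eta, 0 < eta & forall x x' z, K z ->
     `|x| <= M -> `|x'| <= M -> `|x - x'| <= eta -> l x z <= l x' z + e)
  (l_cont : forall x, {within K, continuous (l x)})
  (l_sub : forall x z z', K z -> K z' -> l x (z + z') <= l x z + l (x + z) z')
  (h_improve : forall x, ~ D x ->
     exists z, [/\ K z, D (x + z) & h (x + z) + l x z < h x]).
Implicit Types (x y z : 'rV[R]_n) (M e B : R).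

(** With [l] the impulse cost at time T, [best_jump] is N^D[h] and [hD] is h^D. They are total
    functions through [inf]; [best_jump_attained] shows that the infimum is a minimum. *)
Definition jump_costs x :=
  [set h (x + z) + l x z | z in [set z | K z /\ closure D (x + z)]].
Definition best_jump x := inf (jump_costs x).
Definition hD x := if x \in closure D then Num.min (h x) (best_jump x) else best_jump x.

Lemma best_jump_attained x : exists2 z, K z /\ closure D (x + z) &
  h (x + z) + l x z = best_jump x /\ lbound (jump_costs x) (best_jump x).
Proof.
pose S := [set z | K z /\ closure D (x + z)].
have cx := @continuous_addl R n x.
have [|||B|z Sz zmin] := @coercive_min R n S (fun z => h (x + z) + l x z).
- by have [z Kz Dz] := D_reach x; exists z; split => //; exact: subset_closure.
- apply: closedI => //; apply: (@preimage_closed _ _ (fun z => x + z) (closure D)).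
    by move=> z _; exact: cx.
  exact: closed_closure.
- move=> z; apply: cvgD.
    have : continuous (fun z => h (x + z)).
      by move=> w; apply: continuous_comp; [exact: cx|exact: h_cont].
    by move/continuous_subspaceT; exact.
  by apply: (continuous_subspaceW _ (@l_cont x)) => w [].
- have [M HM] := l_coercive B; exists M => z [Kz _] zB; apply: (HM x) => //.
  by rewrite (le_trans _ zB)// lerDr.
have lb : lbound (jump_costs x) (h (x + z) + l x z) by move=> _ [z' Sz' <-]; exact: zmin.
have zE : h (x + z) + l x z = best_jump x.
  apply/eqP; rewrite eq_le; apply/andP; split.
    by apply: lb_le_inf => //; exists (h (x + z) + l x z); exists z.
  by apply: ge_inf; [exists (h (x + z) + l x z)|exists z].
by exists z => //; split => //; rewrite -zE.
Qed.

Lemma hD_le x : closure D x -> hD x <= h x.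
Proof. by move=> Dx; rewrite /hD mem_set// ge_min lexx. Qed.

Lemma hD_le_best x : hD x <= best_jump x.
Proof. by rewrite /hD; case: ifP => // _; rewrite ge_min lexx orbT. Qed.

Lemma hD_jump x z : K z -> closure D (x + z) -> hD x <= h (x + z) + l x z.
Proof.
move=> Kz Dz; apply: le_trans (hD_le_best x) _.
by have [_ _ [_]] := best_jump_attained x; apply; exists z.
Qed.

Lemma hD_cases x : (closure D x /\ hD x = h x) \/
  exists z, [/\ K z, closure D (x + z) & hD x = h (x + z) + l x z].
Proof.
have [z [Kz Dz] [zE _]] := best_jump_attained x.
rewrite /hD; case: ifPn => [/set_mem Dx|_]; last by right; exists z.
have [_|_] := leP (h x) (best_jump x); [by left|by right; exists z].
Qed.

Lemma hD_ge0 x : 0 <= hD x.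
Proof. by have [[_ ->]//|[z [Kz _ ->]]] := hD_cases x; rewrite addr_ge0 ?l_ge0. Qed.

(** By subadditivity of [l], a jump followed by the optimal jump is no cheaper than the two merged
    into one. Hence h^D cannot be lowered by further impulses at time T. *)
Lemma hD_sub x z : K z -> hD x <= l x z + hD (x + z).
Proof.
move=> Kz; have [[Dx ->]|[z' [Kz' Dz' ->]]] := hD_cases (x + z).
  by rewrite addrC; exact: hD_jump.
rewrite -addrA in Dz' *; apply: le_trans (hD_jump (KD Kz Kz') Dz') _.
by rewrite [leRHS]addrCA lerD2l; exact: l_sub.
Qed.

(** Because D is open, the jump [z] that lands in D from [y] also does so from all nearby points. *)
Lemma hD_usc_of_point y z e : K z -> D (y + z) -> 0 < e ->
  \forall y' \near y, hD y' <= h (y + z) + l y z + e.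
Proof.
move=> Kz Dz e0; have e2 : 0 < e / 2 by rewrite divr_gt0.
have [d d0 Hd] := l_unif (`|y| + 1) e2.
have cy := @continuous_addr R n z.
have D1 : \forall y' \near y, D (y' + z).
  by apply: (cy y); apply: open_nbhs_nbhs; split.
have ch : {for y, continuous (fun y => h (y + z))}.
  by apply: continuous_comp; [exact: cy|exact: h_cont].
near=> y'.
have Dy' : D (y' + z) by near: y'.
have h1 : `|h (y + z) - h (y' + z)| <= e / 2.
  by near: y'; apply: cvgr_dist_le.
have d1 : `|y - y'| <= d by near: y'; apply: cvgr_dist_le => //; exact: cvg_id.
have d2 : `|y - y'| <= 1 by near: y'; apply: cvgr_dist_le => //; exact: cvg_id.
have l1 : l y' z <= l y z + e / 2.
  apply: Hd => //; try by rewrite ?lerDl// distrC.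
  rewrite -(subrK y y') (le_trans (ler_normD _ _))// addrC lerD2l distrC//.
have := hD_jump Kz (subset_closure Dy').
by move: h1; rewrite ler_norml => /andP[]; lra.
Unshelve. all: by end_near. Qed.

Lemma hD_bounded M : exists B, forall x, `|x| <= M -> hD x <= B.
Proof.
(* Each point has a neighbourhood bounded through one jump into D; compactness of the ball makes the
   bound uniform. *)
have := (iffLR (compact_near_coveringP _)) (compact_norm_le (n := n) (M := M)) _
  (pinfty_nbhs R) (fun B x => hD x <= B) _.
case=> [|B [Breal HB]].
  move=> x _; have [z Kz Dz] := D_reach x.
  have H := hD_usc_of_point Kz Dz ltr01.
  exists ([set y' | hD y' <= h (x + z) + l x z + 1], [set B | h (x + z) + l x z + 1 <= B]).
    by split => //=; exact: nbhs_pinfty_ge (num_real _).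
  by move=> [y' B] [/= H1 H2]; exact: le_trans H2.
by exists (B + 1) => x xM; apply: (HB (B + 1)); rewrite ?ltrDl.
Qed.

(** The delicate case is a boundary point [y]: stopping is allowed at [y] but perhaps not at its
    neighbours. There [h_improve] provides a jump into D cheaper than stopping, and that jump is
    stable. *)
Lemma hD_local y e : 0 < e -> \forall y' \near y, hD y' <= h y + e.
Proof.
move=> e0; have [Dy|/h_improve[z [Kz Dz zh]]] := pselect (D y).
  near=> y'.
  have Dy' : D y' by near: y'; apply: open_nbhs_nbhs.
  have h1 : `|h y - h y'| <= e by near: y'; apply: cvgr_dist_le => //; exact: h_cont.
  have := hD_le (subset_closure Dy').
  by move: h1; rewrite ler_norml => /andP[]; lra.
have := hD_usc_of_point Kz Dz e0; apply: filterS => y'; lra.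
Unshelve. all: by end_near. Qed.

Lemma hD_near_h M e : 0 < e -> exists2 eta, 0 < eta & forall y y',
  closure D y -> `|y| <= M -> `|y - y'| <= eta -> hD y' <= h y + e.
Proof.
move=> e0; have e2 : 0 < e / 2 by rewrite divr_gt0.
have H := (iffLR (compact_near_coveringP _)) (compact_norm_le (n := n) (M := M)) _ (0^'+) (fun eta y =>
  forall y', `|y - y'| <= eta -> hD y' <= h y + e) _.
have {}H := H _.
have : \forall eta \near 0^'+, (0 < eta) /\ [set x : 'rV[R]_n | `|x| <= M] `<=`
   (fun y => forall y', `|y - y'| <= eta -> hD y' <= h y + e).
  apply: filterI; first exact: nbhs_right_gt.
  apply: H => y _.
  have /nbhs_ballP[d /= d0 Hd] := hD_local y e2.
  have /cvgrPdist_le/(_ _ e2) h1 := @h_cont y.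
  have d2 : 0 < d / 2 by rewrite divr_gt0.
  (* The radius [d] is halved: one half for moving the centre from [y] to [y1], the other for the
     distance from [y1] to [y']. *)
  exists ([set y' | `|h y - h y'| <= e / 2 /\ `|y - y'| <= d / 2], [set r | r < d / 2]).
    split => /=; last exact: nbhs_right_lt.
    apply: filterI => //; apply/nbhs_ballP; exists (d / 2) => // y1.
    by rewrite -ball_normE/= => /ltW.
  move=> [y1 eta] [/= [h2 h3] h4] y' h5.
  have : hD y' <= h y + e / 2.
    apply: Hd; rewrite -ball_normE/= (le_lt_trans (ler_distD y1 _ _))//; lra.
  by move: h2; rewrite ler_norml => /andP[]; lra.
move=> /filter_ex[eta [eta0 Heta]]; exists eta => // y y' _ yM yy'.
exact: Heta yM _ yy'.
Qed.

(** From [x] the optimal jump [z] of [x'] is imitated. The point [x + z] may miss the closure of D,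
    but it is close to [x' + z], so [hD_near_h] bounds [hD (x + z)] and [hD_sub] absorbs the
    correcting jump. Coercivity bounds [z], so everything happens in one ball. *)
Lemma hD_unif M e : 0 < e -> exists2 eta, 0 < eta & forall x x',
  `|x| <= M -> `|x'| <= M -> `|x - x'| <= eta -> hD x <= hD x' + e.
Proof.
move=> e0; have e2 : 0 < e / 2 by rewrite divr_gt0.
have [B HB] := hD_bounded M.
have [A HA] := l_coercive B.
have [d1 d10 H1] := hD_near_h (M + `|A|) e2.
have [d2 d20 H2] := l_unif M e2.
exists (Num.min d1 d2); first by rewrite lt_min d10.
move=> x x' xM x'M; rewrite le_min => /andP[xd1 xd2].
have x'B := HB _ x'M.
have [[Dx' x'E]|[z [Kz Dz x'E]]] := hD_cases x'.
  rewrite x'E (le_trans (H1 x' x _ _ _))//; [|by rewrite distrC|lra].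
  by rewrite (le_trans x'M) ?lerDl.
have zA : `|z| <= `|A|.
  rewrite (le_trans _ (ler_norm _))// (HA x')// (le_trans _ x'B)// x'E lerDr//.
have := H1 (x' + z) (x + z) Dz.
rewrite (le_trans (ler_normD _ _)) ?lerD// opprD addrACA subrr addr0 distrC => /(_ isT xd1).
have := hD_sub x Kz; have := H2 _ _ _ Kz xM x'M xd2.
lra.
Qed.

End TerminalValue.

(** * First-order expansion of test functions *)
Section ChainRule.
Variable R : realType.

Lemma MVT_signed (u du : R -> R) (a : R) : (forall x : R, is_derive x 1 u (du x)) ->
  exists2 c, `|c| <= `|a| & u a - u 0 = du c * a.
Proof.
move=> ud.
have uc b c : {within `[b, c], continuous u}.
  apply: continuous_subspaceT => x; apply: differentiable_continuous.
  by apply/derivable1_diffP; case: (ud x).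
have [a0|/ltW a0] := leP 0 a.
  have [c /[!in_itv]/=/andP[c0 ca] E] := @MVT_segment R u du 0 a a0 (fun x _ => ud x) (uc _ _).
  by exists c; [rewrite !ger0_norm|rewrite E subr0].
have [c /[!in_itv]/=/andP[ca c0] E] := @MVT_segment R u du a 0 a0 (fun x _ => ud x) (uc _ _).
exists c; first by rewrite !ler0_norm// lerN2.
by rewrite -opprB E sub0r mulrN opprK.
Qed.

Variables (n : nat) (T : R) (phi dt : R -> 'rV[R]_n -> R) (dx : R -> 'rV[R]_n -> 'rV[R]_n).
Hypothesis C1 : C1_slab T phi dt dx.

Lemma C1_slab_time_derive (t : R) x : 0 < t < T -> is_derive t 1 (phi ^~ x) (dt t x).
Proof.
move=> /andP[t0 tT]; have [_ _ _ Hdt _] := C1.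
have := Hdt t x; rewrite in_itv/= !ltW// => /(_ isT) /cvgrPdist_le H.
have cv : (fun h => h^-1 *: (phi (h *: (1 : R) + t) x - phi t x)) @ 0^' --> dt t x.
  apply/cvgrPdist_le => e e0; have := H e e0.
  move=> /nbhs_ballP[d /= d0 Hd].
  (* Small enough for [r + t] to stay in [0, T], where the difference quotients of [C1_slab] are
     controlled. *)
  pose d' := Num.min d (Num.min t (T - t)).
  have d'0 : 0 < d' by rewrite /d' !lt_min d0 t0 subr_gt0.
  apply/nbhs_ballP; exists d' => //= r.
  rewrite -ball_normE/= sub0r normrN !lt_min => /and3P[rd rt rT] r0.
  have := Hd (r + t); rewrite -ball_normE/= opprD addrCA subrr addr0 normrN => /(_ rd).
  rewrite addrK -subr_eq0 addrK => /(_ r0).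
  rewrite /GRing.scale/= mulr1 mulrC; apply.
  rewrite in_itv/=; move: rt rT; rewrite !ltr_norml => /andP[? ?] /andP[? ?]; lra.
apply: DeriveDef; first by apply/cvg_ex; exists (dt t x).
exact: cvg_lim cv.
Qed.

Lemma C1_slab_dir_derive (t : R) (x : 'rV[R]_n) (i : 'I_n) (r : R) : 0 <= t <= T ->
  is_derive r 1 (fun r : R => phi t (x + r *: delta_mx 0 i)) (dx t (x + r *: delta_mx 0 i) 0 i).
Proof.
move=> t0T; have [_ _ _ _ Hdx] := C1.
have := Hdx t (x + r *: delta_mx 0 i) i; rewrite in_itv/= => /(_ t0T) [ed dv].
have E : (fun h : R => h^-1 *: (phi t (x + (h *: (1 : R) + r) *: delta_mx 0 i) -
                            phi t (x + r *: delta_mx 0 i))) =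
  (fun h : R => h^-1 *: ((phi t \o shift (x + r *: delta_mx 0 i)) (h *: delta_mx 0 i) -
       phi t (x + r *: delta_mx 0 i))).
  apply/funext => h /=; congr (_ *: (phi t _ - _)).
  have -> : h *: (1 : R) = h by rewrite /GRing.scale/= mulr1.
  by rewrite scalerDl addrCA.
by apply: DeriveDef; rewrite /derivable /derive /= E.
Qed.

Lemma continuous_slab_dist (U : normedModType R) (G : R -> 'rV[R]_n -> U) (t : R) (x : 'rV[R]_n) (e : R) :
  continuous_slab T G -> 0 <= t <= T -> 0 < e ->
  exists2 eta, 0 < eta & forall s y, 0 <= s <= T -> `|s - t| <= eta -> `|y - x| <= eta ->
     `|G s y - G t x| <= e.
Proof.
move=> cG t0T e0.
have /subspace_continuousP/(_ (t, x)) : {within @slab R n T, continuous (fun p => G p.1 p.2)} by [].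
rewrite /slab/= in_itv/= => /(_ t0T) /cvgrPdist_le/(_ _ e0).
move=> /nbhs_ballP[d /= d0 Hd]; exists (d / 2); first by rewrite divr_gt0.
move=> s y s0T st yx; rewrite distrC; apply: (Hd (s, y)) => /=; last by rewrite in_itv.
by split; rewrite -ball_normE/= distrC; lra.
Qed.

(** Only partial derivatives are given, so the increment is split into [n] coordinate steps; joint
    continuity of [dx] makes the estimate uniform over times [s] near [t]. *)
Lemma C1_slab_space_increment (t : R) (x : 'rV[R]_n) (e : R) : 0 <= t <= T -> 0 < e ->
  exists2 eta, 0 < eta & forall s y, 0 <= s <= T -> `|s - t| <= eta -> `|y - x| <= eta ->
    `|phi s y - phi s x - dotp (dx t x) (y - x)| <= e * (n%:R * `|y - x|).
Proof.
move=> t0T e0; have [_ _ cdx _ _] := C1.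
have [d d0 Hd] := continuous_slab_dist x cdx t0T e0.
exists d => // s y s0T st yx.
(* A path from [x] to [y] that changes one coordinate at a time, so that the one-variable mean value
   theorem applies to each step. *)
pose z k : 'rV[R]_n := \row_i (if (i < k)%N then y 0 i else x 0 i).
have z0 : z 0%N = x by apply/rowP => i; rewrite mxE.
have zn : z n = y by apply/rowP => i; rewrite mxE ltn_ord.
have zS (k : 'I_n) : z k.+1 = z k + (y 0 k - x 0 k) *: delta_mx 0 k.
  apply/rowP => i; rewrite !mxE/= ltnS -val_eqE/=.
  by case: ltngtP => //= ik; rewrite ?mulr0 ?addr0// mulr1 (val_inj ik) addrC subrK.
have step (k : 'I_n) : `|phi s (z k.+1) - phi s (z k) - dx t x 0 k * (y 0 k - x 0 k)| <= e * `|y - x|.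
  have [c ca] := MVT_signed (y 0 k - x 0 k) (fun r => @C1_slab_dir_derive s (z k) k r s0T).
  rewrite -zS scale0r addr0 => ->; rewrite -mulrBl normrM ler_pM//; last first.
    by have := rV_coord_le (y - x) k; rewrite !mxE.
  rewrite (_ : _ - dx t x 0 k = (dx s (z k + c *: delta_mx 0 k) - dx t x) 0 k); last by rewrite !mxE.
  rewrite (le_trans (rV_coord_le _ _))// Hd//.
  apply/rV_norm_leP; first exact: le_trans yx.
  move=> i; rewrite !mxE/=; have yxi := rV_coord_le (y - x) i; rewrite !mxE in yxi.
  have [ki|ki] := eqVneq i k.
    subst i; rewrite ltnn mulr1 addrC addKr (le_trans ca)//.
    exact: le_trans yx.
  rewrite mulr0 addr0; case: ifP => _; first exact: le_trans yx.
  by rewrite subrr normr0 (le_trans _ yx).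
rewrite -{1}zn -{1}z0 -(telescope_sumr (fun k => phi s (z k)) (leq0n n)) big_mkord.
rewrite /dotp -sumrB.
rewrite (le_trans (ler_norm_sum _ _ _))// (le_trans (ler_sum _ (fun i _ => _ : _ <= e * `|y - x|)))//.
  by move=> i _; have := step i; rewrite !mxE.
by rewrite sumr_const card_ord -[_ *+ n]mulr_natr -mulrA [n%:R * _]mulrC.
Qed.

(** The move is made in space at time [t] and then in time at the point [y]. Only forward times
    occur, which admits [t = 0]. *)
Lemma C1_slab_increment (t : R) (x : 'rV[R]_n) (e : R) : 0 <= t < T -> 0 < e ->
  exists2 eta, 0 < eta & forall s y, t <= s <= T -> s - t <= eta -> `|y - x| <= eta ->
    `|phi s y - phi t x - (dt t x * (s - t) + dotp (dx t x) (y - x))|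
      <= e * ((s - t) + n%:R * `|y - x|).
Proof.
move=> /andP[t0 tT] e0; have [cphi cdt _ _ _] := C1.
have t0T : 0 <= t <= T by rewrite t0 ltW.
have [d1 d10 H1] := C1_slab_space_increment x t0T e0.
have [d2 d20 H2] := continuous_slab_dist x cdt t0T e0.
exists (Num.min d1 d2); first by rewrite lt_min d10.
move=> s y /andP[ts sT]; rewrite !le_min => /andP[sd1 sd2] /andP[yd1 yd2].
have s0T : 0 <= s <= T by rewrite sT (le_trans t0).
have cp : {within `[t, s], continuous (phi ^~ y)}.
  apply/subspace_continuousP => r; rewrite /= in_itv/= => /andP[tr rs].
  have r0T : 0 <= r <= T by rewrite (le_trans t0 tr) (le_trans rs).
  apply/cvgrPdist_le => e1 e10.
  have [d d0 Hd] := continuous_slab_dist y cphi r0T e10.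
  apply/nbhs_ballP; exists d => //= q; rewrite -ball_normE/= => /ltW rq.
  rewrite in_itv/= => /andP[tq qs]; rewrite distrC; apply: Hd.
  - by rewrite (le_trans t0 tq) (le_trans qs).
  - by rewrite distrC.
  - by rewrite subrr normr0 ltW.
(* Differentiability is asked only strictly between [t] and [s], hence inside (0, T), where the time
   derivative is two-sided. *)
have [c /[!in_itv]/=/andP[tc cs] E] := @MVT_segment R (phi ^~ y) (fun r => dt r y) t s ts
   ltac:(by move=> r /[!in_itv]/=/andP[tr rs]; apply: C1_slab_time_derive;
      rewrite (le_lt_trans t0 tr) (lt_le_trans rs)) cp.
have A1 := H1 t y t0T ltac:(by rewrite subrr normr0 ltW) yd1.
have A2 : `|dt c y - dt t x| <= e.
  apply: H2 => //; first by rewrite (le_trans t0 tc) (le_trans cs).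
  by rewrite ger0_norm ?subr_ge0// (le_trans _ sd2)// lerD2r.
have -> : phi s y - phi t x - (dt t x * (s - t) + dotp (dx t x) (y - x)) =
   (dt c y - dt t x) * (s - t) + (phi t y - phi t x - dotp (dx t x) (y - x)).
  by rewrite mulrBl -E; ring.
rewrite (le_trans (ler_normD _ _))// [leRHS]mulrDr lerD// normrM.
by rewrite [X in _ * X]ger0_norm ?subr_ge0// ler_wpM2r ?subr_ge0.
Qed.

Lemma dotp_bound (u v : 'rV[R]_n) : `|dotp u v| <= n%:R * `|u| * `|v|.
Proof.
rewrite /dotp (le_trans (ler_norm_sum _ _ _))//.
rewrite (le_trans (ler_sum _ (fun i _ => _ : _ <= `|u| * `|v|)))//.
  by move=> i _; rewrite normrM ler_pM// rV_coord_le.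
by rewrite sumr_const card_ord -[_ *+ n]mulr_natl -mulrA.
Qed.

Lemma dotpDr (u v w : 'rV[R]_n) : dotp u (v + w) = dotp u v + dotp u w.
Proof. by rewrite /dotp -big_split; apply: eq_bigr => i _; rewrite !mxE mulrDr. Qed.

Lemma dotpZr (u v : 'rV[R]_n) a : dotp u (a *: v) = a * dotp u v.
Proof. by rewrite /dotp mulr_sumr; apply: eq_bigr => i _; rewrite !mxE mulrCA. Qed.

End ChainRule.

(** * The unconstrained impulse problem *)
Section Controlled.
Variables (R : realType) (n : nat) (F : R -> 'rV[R]_n -> 'rV[R]_n) (C T : R).
Hypotheses (C0 : 0 < C) (T0 : 0 < T)
  (cF : continuous (fun p : R * 'rV[R]_n => F p.1 p.2))
  (lipF : forall t x y, `|F t x - F t y| <= C * `|x - y|)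
  (F0 : forall t, `|F t 0| <= C).
Implicit Types (t s : R) (x y xi : 'rV[R]_n) (c : seq (R * 'rV[R]_n)) (M e : R).

Local Notation mu := (@lebesgue_measure R).
Local Notation Phi := (flow F).

(** One constant above both the factor 2 of [flow_lip] and the factor 2 C of [flow_growth], with the
    exponential weight at its largest value on [0, T]. *)
Definition flow_const := 2 * (1 + C) * expR (2 * C * T).
Local Notation kap := flow_const.

Lemma flow_const_ge2 : 2 <= kap.
Proof.
have e1 : 1 <= expR (2 * C * T) by rewrite -expR0 ler_expR !mulr_ge0// ltW.
have C0' := C0.
have : 1 * 1 <= (1 + C) * expR (2 * C * T) by apply: ler_pM => //; lra.
by rewrite /flow_const -mulrA; lra.
Qed.

Lemma expw_le t s : 0 <= t -> s <= T -> expR (2 * C * (s - t)) <= expR (2 * C * T).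
Proof. move=> t0 sT; rewrite ler_expR ler_wpM2l ?mulr_ge0 ?(ltW C0)//; lra. Qed.

Lemma flow_lipT t s x y : 0 <= t -> t <= s -> s <= T ->
  `|Phi t x s - Phi t y s| <= kap * `|x - y|.
Proof.
move=> t0 ts sT; apply: le_trans (flow_lip C0 cF lipF F0 _ _ ts) _.
have e0 := expw_le t0 sT; have E0 := expR_gt0 (2 * C * (s - t)).
have C0' := C0; rewrite mulrAC /flow_const ler_wpM2r// ler_pM// ?mulr_ge0 ?ltW//; lra.
Qed.

Lemma flow_growthT t s x M : 0 <= t -> t <= s -> s <= T -> `|x| <= M ->
  `|Phi t x s - x| <= kap * (1 + M) * (s - t).
Proof.
move=> t0 ts sT xM; apply: le_trans (flow_growth C0 cF lipF F0 _ ts) _.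
have e0 := expw_le t0 sT; have E0 := expR_gt0 (2 * C * (s - t)).
have C0' := C0; have x0 := normr_ge0 x; have d0 : 0 <= s - t by rewrite subr_ge0.
rewrite !mulrA [leLHS]mulrAC ler_wpM2r// [leLHS]mulrAC.
apply: ler_pM; rewrite ?mulr_ge0 ?addr_ge0 ?(ltW C0) ?(ltW E0)//; last lra.
rewrite /flow_const; apply: ler_pM; rewrite ?mulr_ge0 ?(ltW C0) ?(ltW E0)//; lra.
Qed.

Lemma flow_bound t s x M : 0 <= t -> t <= s -> s <= T -> `|x| <= M ->
  `|Phi t x s| <= M + kap * (1 + M) * T.
Proof.
move=> t0 ts sT xM; have M0 := le_trans (normr_ge0 x) xM.
rewrite -(subrK x (Phi t x s)) addrC (le_trans (ler_normD _ _))// lerD//.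
rewrite (le_trans (flow_growthT t0 ts sT xM))// ler_wpM2l//; last lra.
by rewrite mulr_ge0 ?addr_ge0//; have := flow_const_ge2; lra.
Qed.

(** * Running cost along the flow and its dependence on the initial data *)

Variable g : R -> 'rV[R]_n -> R.
Hypotheses (cg : continuous (fun p : R * 'rV[R]_n => g p.1 p.2))
  (g_ge0 : forall t x, 0 <= g t x)
  (g_bnd : forall M, exists B, forall t x, `|x| <= M -> g t x <= B)
  (g_unif : forall M e, 0 < e -> exists2 eta, 0 < eta & forall t x x',
     `|x| <= M -> `|x'| <= M -> `|x - x'| <= eta -> `|g t x - g t x'| <= e).

Definition gcost t x s := \int[mu]_(r in `[t, s]) g r (Phi t x r).

Lemma gflow_continuous t x : continuous (fun r => g r (Phi t x r)).
Proof. apply: continuous_along => //; exact: (flow_continuous C0). Qed.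

Lemma gcost_ge0 t x s : 0 <= gcost t x s.
Proof. exact: Rintegral_ge0. Qed.

Lemma gcost_id t x : gcost t x t = 0.
Proof. exact: Rintegral_lt_itv. Qed.

Lemma gcost_chasles t x s r : t <= s -> s <= r ->
  gcost t x r = gcost t x s + gcost s (Phi t x s) r.
Proof.
move=> ts sr; rewrite /gcost (Rintegral_chasles ts sr); last first.
  by apply: continuous_integrable; exact: gflow_continuous.
congr (_ + _); apply: eq_Rintegral => q; rewrite inE/= in_itv/= => /andP[sq _].
by rewrite (flow_semigroup C0).
Qed.

Lemma gcost_small M e : 0 < e -> exists2 eta, 0 < eta & forall t s x,
  0 <= t -> t <= s -> s <= T -> `|x| <= M -> s - t <= eta -> gcost t x s <= e.
Proof.
move=> e0; have [B gB] := g_bnd (M + kap * (1 + M) * T).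
pose B1 := Num.max B 1.
have B10 : 0 < B1 by rewrite lt_max ltr01 orbT.
exists (e / B1); first by rewrite divr_gt0.
move=> t s x t0 ts sT xM st; rewrite (le_trans (ler_norm _))//.
rewrite (le_trans (Rintegral_bound (k := B1) ts _ _))//.
- by apply: continuous_integrable; exact: gflow_continuous.
- move=> r /andP[tr rs]; rewrite ger0_norm// le_max gB// flow_bound//.
  exact: le_trans sT.
- by rewrite mulrC -ler_pdivlMr.
Qed.

(** [Num.max s t'] is the time to which an impulse due at [s] is postponed when the start moves from
    [t] to [t']. The two states are compared by growth up to [t'] and by Lipschitz dependence
    afterwards. *)
Lemma flow_compare M e : 0 < e -> exists2 eta, 0 < eta & forall t t' s x x',
  0 <= t -> t <= t' -> t' <= T -> t <= s -> s <= T -> `|x| <= M -> `|x'| <= M ->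
  `|x - x'| <= eta -> t' - t <= eta ->
  `|Phi t' x' (Num.max s t') - Phi t x s| <= e.
Proof.
move=> e0; have k2 := flow_const_ge2.
(* [w] bounds the drift per unit time from the ball. At time [t'] the states differ by at most [eta]
   (initial gap) plus [w * eta] (drift), and the flow then multiplies this by at most [kap]. *)
pose w := kap * (1 + `|M|).
have w0 : 0 <= w by rewrite mulr_ge0 ?addr_ge0//; lra.
have kw : 0 < kap * (1 + w) by rewrite mulr_gt0//; lra.
have [eta eta0 etaE] : exists2 eta, 0 < eta & kap * ((1 + w) * eta) = e.
  exists (e / (kap * (1 + w))); first by rewrite divr_gt0.
  by rewrite mulrA mulrC divfK ?lt0r_neq0.
have e1 : (1 + w) * eta <= kap * ((1 + w) * eta).
  rewrite ler_peMl// ?mulr_ge0 ?(ltW eta0) ?addr_ge0//.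
  by apply: le_trans k2; rewrite ler1n.
rewrite etaE in e1.
exists eta => // t t' s x x' t0 tt' t'T ts sT xM x'M d1 d2.
have xM' : `|x| <= `|M| by rewrite (le_trans xM) ?ler_norm.
have H r : t <= r -> r <= t' -> `|x' - Phi t x r| <= (1 + w) * eta.
  move=> tr rt'; rewrite (le_trans (ler_distD x _ _))// distrC [X in _ + X]distrC.
  rewrite mulrDl mul1r lerD// (le_trans (flow_growthT t0 tr (le_trans rt' t'T) xM'))//.
  by rewrite ler_wpM2l// (le_trans _ d2)// lerB.
have [st'|t's] := leP s t'; first by rewrite (flow_id C0)// (le_trans (H _ _ _)).
rewrite -(flow_semigroup C0 cF lipF F0 x tt' (ltW t's)) -etaE.
rewrite (le_trans (flow_lipT _ _ _ _ _))//; [exact: le_trans tt'|exact: ltW|].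
rewrite ler_wpM2l//; [lra|exact: H].
Qed.

(** A later start saves the nonnegative cost on [t, t']; on the rest the integrands differ by at
    most e / T. *)
Lemma gcost_compare M e : 0 < e -> exists2 eta, 0 < eta & forall t t' s x x',
  0 <= t -> t <= t' -> t' <= T -> t <= s -> s <= T -> `|x| <= M -> `|x'| <= M ->
  `|x - x'| <= eta -> t' - t <= eta ->
  gcost t' x' (Num.max s t') <= gcost t x s + e.
Proof.
move=> e0.
have [d d0 gd] := g_unif (M + kap * (1 + M) * T) ltac:(exact: divr_gt0 e0 T0).
have [eta eta0 H] := flow_compare M d0.
exists eta => // t t' s x x' t0 tt' t'T ts sT xM x'M d1 d2.
have [st'|t's] := leP s t'; first by rewrite gcost_id addr_ge0 ?gcost_ge0 ?ltW.
have t'0 := le_trans t0 tt'.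
rewrite (gcost_chasles x tt' (ltW t's)) -addrA addrC -[leLHS]addr0 lerD ?gcost_ge0//.
have ig q y : mu.-integrable `[t', s] (EFin \o fun r => g r (Phi q y r)).
  by apply: continuous_integrable; exact: gflow_continuous.
rewrite -lerBlDl /gcost -RintegralB// (le_trans (ler_norm _))//.
rewrite (le_trans (Rintegral_bound (k := e / T) (ltW t's) _ _))//.
- by apply: continuous_integrable => r; apply: cvgB; exact: gflow_continuous.
- move=> r /andP[t'r rs]; have rT := le_trans rs sT.
  rewrite (flow_semigroup C0)//; apply: gd.
  + exact: flow_bound.
  + by apply: flow_bound => //; exact: le_trans t'r.
  + have := H t t' r x x'; rewrite max_l//; apply => //; exact: le_trans t'r.
- rewrite mulrAC ler_pdivrMr// ler_wpM2l ?(ltW e0)//; lra.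
Qed.

(** * Impulse controls and their total cost, by recursion on the list *)

Variables (K : set 'rV[R]_n) (ell : R -> 'rV[R]_n -> 'rV[R]_n -> R) (ell0 : R).
Hypotheses (ell0_gt0 : 0 < ell0)
  (ell_ge : forall t x xi, 0 <= t <= T -> K xi -> ell0 <= ell t x xi)
  (ell_coercive : forall B, exists M, forall t x xi,
     0 <= t <= T -> K xi -> ell t x xi <= B -> `|xi| <= M)
  (ell_unif : forall M e, 0 < e -> exists2 eta, 0 < eta & forall t x x' xi,
     0 <= t <= T -> K xi ->
     `|x| <= M -> `|x'| <= M -> `|x - x'| <= eta -> ell t x xi <= ell t x' xi + e)
  (ell_decr : forall s t x xi, 0 <= s -> s <= t -> t <= T -> K xi ->
     ell t x xi <= ell s x xi).

(** Recursive form of [impulse_control] (equivalence in [ctrlP]): each tail is a control that starts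
    at the preceding impulse time, as inductions along the list require. *)
Fixpoint ctrl t c : Prop :=
  if c is p :: c' then [/\ t <= p.1 <= T, K p.2 & ctrl p.1 c'] else True.

Fixpoint running t x c : R :=
  if c is p :: c' then
    gcost t x p.1 + ell p.1 (Phi t x p.1) p.2 + running p.1 (Phi t x p.1 + p.2) c'
  else gcost t x T.

Fixpoint endpoint t x c : 'rV[R]_n :=
  if c is p :: c' then endpoint p.1 (Phi t x p.1 + p.2) c' else Phi t x T.

Definition delay t c : seq (R * 'rV[R]_n) := [seq (Num.max p.1 t, p.2) | p <- c].

Lemma ctrl_le t s c : s <= t -> ctrl t c -> ctrl s c.
Proof.
by move=> st; case: c => //= p c [/andP[tp pT] Kp cp]; split; rewrite ?(le_trans st).
Qed.

(** A control from [s] has no impulse before [s]. This lets the induction on a delayed control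
    restart at its first, possibly postponed, impulse time. *)
Lemma delay_max s t c : ctrl s c -> delay (Num.max s t) c = delay t c.
Proof.
elim: c => //= p c ih [/andP[sp pT] Kp cp]; rewrite (ih (ctrl_le sp cp)).
by rewrite maxA [in X in Num.max X _]max_l.
Qed.

Lemma ctrl_delay t t' c : t' <= T -> ctrl t c -> ctrl t' (delay t' c).
Proof.
move=> t'T cc; apply: (@ctrl_le (Num.max t t') t'); first by rewrite le_max lexx orbT.
elim: c t cc => //= p c ih t [/andP[tp pT] Kp /ih]; split => //=.
by rewrite ge_max !le_max tp lexx orbT/= ge_max pT.
Qed.

Variable k : 'rV[R]_n -> R.
Hypotheses (k_ge0 : forall x, 0 <= k x)
  (k_bnd : forall M, exists B, forall x, `|x| <= M -> k x <= B)
  (k_unif : forall M e, 0 < e -> exists2 eta, 0 < eta & forall x x',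
     `|x| <= M -> `|x'| <= M -> `|x - x'| <= eta -> k x <= k x' + e).

Definition total t x c := running t x c + k (endpoint t x c).

Lemma total_nil t x : total t x [::] = gcost t x T + k (Phi t x T).
Proof. by []. Qed.

Lemma total_cons t x p c : total t x (p :: c) =
  gcost t x p.1 + (ell p.1 (Phi t x p.1) p.2 + total p.1 (Phi t x p.1 + p.2) c).
Proof. by rewrite /total /= !addrA. Qed.

Lemma total_split t s x c : t <= s -> s <= T -> ctrl s c ->
  total t x c = gcost t x s + total s (Phi t x s) c.
Proof.
case: c => [|p c] ts sT /=.
  by rewrite !total_nil addrA -(gcost_chasles _ ts sT) (flow_semigroup C0).
move=> [/andP[sp pT] Kp cp].
by rewrite !total_cons (gcost_chasles x ts sp) (flow_semigroup C0)// -!addrA.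
Qed.

Lemma total_nil_compare M e : 0 < e -> exists2 eta, 0 < eta & forall t t' x x',
  0 <= t -> t <= t' -> t' <= T -> `|x| <= M -> `|x'| <= M ->
  `|x - x'| <= eta -> t' - t <= eta -> total t' x' [::] <= total t x [::] + e.
Proof.
move=> e0; have e2 : 0 < e / 2 by rewrite divr_gt0.
have [d1 d10 H1] := gcost_compare M e2.
have [d2 d20 H2] := k_unif (M + kap * (1 + M) * T) e2.
have [d3 d30 H3] := flow_compare M d20.
exists (Num.min d1 d3); first by rewrite lt_min d10.
move=> t t' x x' t0 tt' t'T xM x'M; rewrite !le_min => /andP[xd1 xd3] /andP[td1 td3].
rewrite !total_nil; have tT := le_trans tt' t'T.
have := H1 t t' T x x' t0 tt' t'T tT (lexx _) xM x'M xd1 td1.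
have := H3 t t' T x x' t0 tt' t'T tT (lexx _) xM x'M xd3 td3.
rewrite max_l// => a1 a2.
have := H2 _ _ (flow_bound (le_trans t0 tt') t'T (lexx _) x'M) (flow_bound t0 tT (lexx _) xM) a1.
lra.
Qed.

(* Postponing the early impulses of c to t' does not raise their cost, because ell
   decreases in time. *)
Lemma total_delay N B M e : 0 < e -> exists2 eta, 0 < eta & forall t t' x x' c,
  0 <= t -> t <= t' -> t' <= T -> `|x| <= M -> `|x'| <= M ->
  `|x - x'| <= eta -> t' - t <= eta ->
  ctrl t c -> (size c <= N)%N -> all (fun p => `|p.2| <= B) c ->
  total t' x' (delay t' c) <= total t x c + e.
Proof.
elim: N M e => [|N ih] M e e0; have [d0 d00 H0] := total_nil_compare M e0.
  exists d0 => // t t' x x' c t0 tt' t'T xM x'M xd td _.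
  by rewrite leqn0 size_eq0 => /eqP -> _; exact: H0.
pose M1 := M + kap * (1 + M) * T.
have e3 : 0 < e / 3 by rewrite divr_gt0.
have [d1 d10 H1] := gcost_compare M e3.
have [d2 d20 H2] := ell_unif M1 e3.
(* Each impulse enlarges the ball from M to M1 + B, so the modulus depends on the bounds [N] and
   [B]. The tail's modulus [d4] is fixed first, because the states at the first impulse must come
   within it. *)
have [d4 d40 H4] := ih (M1 + B) _ e3.
have d240 : 0 < Num.min d2 d4 by rewrite lt_min d20.
have [d3 d30 H3] := flow_compare M d240.
exists (Num.min d0 (Num.min d1 (Num.min d3 d4))); first by rewrite !lt_min d10 d30 d00.
move=> t t' x x' c t0 tt' t'T xM x'M.
rewrite !le_min => /and4P[xd0 xd1 xd3 xd4] /and4P[td0 td1 td3 td4].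
have tT := le_trans tt' t'T; have t'0 := le_trans t0 tt'.
case: c => [|[s z] c] /=.
  by move=> _ _ _; exact: H0.
move=> [/andP[/= ts sT] Kz cc]; rewrite ltnS => cN /andP[zB cB].
have s0 := le_trans t0 ts.
rewrite !total_cons/=; set s' := Num.max s t'.
have ss' : s <= s' by rewrite le_max lexx.
have t's' : t' <= s' by rewrite le_max lexx orbT.
have s'T : s' <= T by rewrite ge_max sT.
have G1 := H1 t t' s x x' t0 tt' t'T ts sT xM x'M xd1 td1.
have := H3 t t' s x x' t0 tt' t'T ts sT xM x'M xd3 td3.
rewrite -/s' le_min => /andP[F2 F4].
have B1 := flow_bound t0 ts sT xM.
have B1' := flow_bound t'0 t's' s'T x'M.
have G2 : ell s' (Phi t' x' s') z <= ell s (Phi t x s) z + e / 3.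
  apply: le_trans (ell_decr (Phi t' x' s') s0 ss' s'T Kz) _.
  by apply: H2 => //; rewrite s0.
have G3 : total s' (Phi t' x' s' + z) (delay t' c) <= total s (Phi t x s + z) c + e / 3.
  rewrite -(delay_max t' cc); apply: H4 => //.
  - by rewrite (le_trans (ler_normD _ _))// lerD.
  - by rewrite (le_trans (ler_normD _ _))// lerD.
  - by rewrite opprD addrACA subrr addr0 distrC.
  (* The impulse is postponed by t' - s <= t' - t, or not at all. *)
  - apply: le_trans td4; by rewrite /s'; have [_|_] := leP s t'; [exact: lerB|rewrite subrr subr_ge0].
lra.
Qed.

Lemma running_ge t x c : 0 <= t -> ctrl t c -> (size c)%:R * ell0 <= running t x c.
Proof.
elim: c t x => [|p c ih] t x t0 /=; first by rewrite mul0r gcost_ge0.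
move=> [/andP[tp pT] Kp cc]; have p0 := le_trans t0 tp.
rewrite -natr1 mulrDl mul1r addrC lerD// ?ih//.
by rewrite -[leLHS]add0r lerD ?gcost_ge0// ell_ge// p0.
Qed.

Lemma running_ge0 t x c : 0 <= t -> ctrl t c -> 0 <= running t x c.
Proof. by move=> t0 /(running_ge x t0); apply: le_trans; rewrite mulr_ge0// ltW. Qed.

Lemma running_jumps_bound B : exists M, forall t x c, 0 <= t -> ctrl t c ->
  running t x c <= B -> all (fun p => `|p.2| <= M) c.
Proof.
have [M HM] := ell_coercive B; exists M => t x c; elim: c t x => //= p c ih t x t0.
move=> [/andP[tp pT] Kp cc] H; have p0 := le_trans t0 tp.
have r0 := running_ge0 (Phi t x p.1 + p.2) p0 cc.
have g0 := gcost_ge0 t x p.1.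
have l0 : 0 <= ell p.1 (Phi t x p.1) p.2.
  by rewrite (le_trans (ltW ell0_gt0))// ell_ge// p0.
rewrite (HM p.1 (Phi t x p.1))//=; first by apply: (ih p.1 (Phi t x p.1 + p.2)) => //; lra.
  by rewrite p0.
lra.
Qed.

Lemma total_ge0 t x c : 0 <= t -> ctrl t c -> 0 <= total t x c.
Proof. by move=> t0 cc; rewrite addr_ge0// running_ge0. Qed.

(* Value of the problem with terminal cost k and no terminal constraint; for k = h^D
   it is the value of the constrained problem. *)
Definition free_value t x := inf [set total t x c | c in ctrl t].
Local Notation W := free_value.

Lemma free_value_le t x c : 0 <= t -> ctrl t c -> W t x <= total t x c.
Proof.
move=> t0 cc; apply: ge_inf; last by exists c.
by exists 0 => _ [c' cc' <-]; exact: total_ge0.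
Qed.

Lemma free_value_ge t x b : (forall c, ctrl t c -> b <= total t x c) -> b <= W t x.
Proof.
move=> H; apply: lb_le_inf; first by exists (total t x [::]); exists [::].
by move=> _ [c cc <-]; exact: H.
Qed.

Lemma free_value_ge0 t x : 0 <= t -> 0 <= W t x.
Proof. by move=> t0; apply: free_value_ge => c; exact: total_ge0. Qed.

Lemma free_value_approx t x e : 0 <= t -> 0 < e ->
  exists2 c, ctrl t c & total t x c <= W t x + e.
Proof.
move=> t0 e0; have hi : has_inf [set total t x c | c in ctrl t].
  split; first by exists (total t x [::]); exists [::].
  by exists 0 => _ [c' cc' <-]; exact: total_ge0.
by have [_ [c cc <-] /ltW] := inf_adherent e0 hi; exists c.
Qed.

Lemma free_value_bounded M : exists B, forall t x, 0 <= t -> t <= T -> `|x| <= M -> W t x <= B.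
Proof.
have [B1 g1] := g_bnd (M + kap * (1 + M) * T).
have [B2 k2] := k_bnd (M + kap * (1 + M) * T).
exists (`|B1| * T + B2) => t x t0 tT xM.
rewrite (le_trans (@free_value_le t x [::] t0 I))// total_nil lerD//; last first.
  by rewrite k2// flow_bound.
rewrite (le_trans (ler_norm _))// (le_trans (Rintegral_bound (k := `|B1|) tT _ _))//.
- by apply: continuous_integrable; exact: gflow_continuous.
- by move=> r /andP[tr rs]; rewrite ger0_norm// (le_trans (g1 _ _ _)) ?ler_norm// flow_bound.
- rewrite ler_wpM2l//; lra.
Qed.

Lemma free_value_near_optimal M : exists N, exists B, forall t x e,
  0 <= t -> t <= T -> `|x| <= M -> 0 < e <= 1 ->
  exists c, [/\ ctrl t c, (size c <= N)%N, all (fun p => `|p.2| <= B) c &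
    total t x c <= W t x + e].
Proof.
have [A HA] := free_value_bounded M.
have [B HB] := running_jumps_bound (A + 1).
(* [A] bounds the value on the ball and e <= 1, so the cost is at most A + 1, of which every impulse
   takes at least [ell0]. *)
exists (Num.truncn ((A + 1) / ell0)), B => t x e t0 tT xM /andP[e0 e1].
have [c cc ce] := free_value_approx x t0 e0; exists c.
have := HA t x t0 tT xM => WA.
have rA : running t x c <= A + 1.
  by move: ce; rewrite /total; have := k_ge0 (endpoint t x c); lra.
split => //; last exact: HB rA.
have := le_trans (running_ge x t0 cc) rA; rewrite -ler_pdivlMr// => H.
by rewrite truncn_ge_nat// (le_trans _ H).
Qed.

Lemma free_value_delay M e : 0 < e -> exists2 eta, 0 < eta & forall t t' x x',
  0 <= t -> t <= t' -> t' <= T -> `|x| <= M -> `|x'| <= M ->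
  `|x - x'| <= eta -> t' - t <= eta -> W t' x' <= W t x + e.
Proof.
move=> e0; have [N [B H]] := free_value_near_optimal M.
have e2 : 0 < e / 2 by rewrite divr_gt0.
have [d d0 Hd] := total_delay N B M e2.
exists d => // t t' x x' t0 tt' t'T xM x'M xd td.
have [||c [cc cN cB ce]] := H t x (Num.min 1 (e / 2)) t0 _ xM; first exact: le_trans t'T.
  by rewrite lt_min ltr01 e2 ge_min lexx.
have := Hd t t' x x' c t0 tt' t'T xM x'M xd td cc cN cB.
have := free_value_le x' (le_trans t0 tt') (ctrl_delay t'T cc).
have : Num.min 1 (e / 2) <= e / 2 by rewrite ge_min lexx orbT.
lra.
Qed.

Lemma free_value_dpp_flow t s x : 0 <= t -> t <= s -> s <= T ->
  W t x <= gcost t x s + W s (Phi t x s).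
Proof.
move=> t0 ts sT; rewrite -lerBlDl; apply: free_value_ge => c cc.
by rewrite lerBlDl -total_split// free_value_le//; exact: ctrl_le cc.
Qed.

(** From the earlier time one waits along the flow until [t']; what remains is a comparison of two
    states at the same time, given by [free_value_delay]. *)
Lemma free_value_advance M e : 0 < e -> exists2 eta, 0 < eta & forall t t' x x',
  0 <= t -> t <= t' -> t' <= T -> `|x| <= M -> `|x'| <= M ->
  `|x - x'| <= eta -> t' - t <= eta -> W t x <= W t' x' + e.
Proof.
move=> e0; have e2 : 0 < e / 2 by rewrite divr_gt0.
have [d1 d10 H1] := gcost_small M e2.
have [d2 d20 H2] := free_value_delay (M + kap * (1 + M) * T) e2.
have [d3 d30 H3] := flow_compare M d20.
exists (Num.min d1 d3); first by rewrite lt_min d10.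
move=> t t' x x' t0 tt' t'T xM x'M; rewrite !le_min => /andP[xd1 xd3] /andP[td1 td3].
have t'0 := le_trans t0 tt'.
have a1 := H1 t t' x t0 tt' t'T xM td1.
have := H3 t t' t' x x' t0 tt' t'T tt' t'T xM x'M xd3 td3.
rewrite maxxx (flow_id C0)// => a2.
have a3 := H2 t' t' x' (Phi t x t') t'0 (lexx _) t'T.
have M0 := le_trans (normr_ge0 x) xM.
(* Since [Phi t' x' t'] is [x'], [flow_bound] also puts [x'] into the larger ball. *)
have x'M' : `|x'| <= M + kap * (1 + M) * T.
  by rewrite -(flow_id C0 cF lipF F0 x' (lexx t')) flow_bound.
have {}a3 := a3 x'M' (flow_bound t0 tt' t'T xM) a2 ltac:(by rewrite subrr ltW).
have := free_value_dpp_flow x t0 tt' t'T; lra.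
Qed.

Lemma free_value_unif M e : 0 < e -> exists2 eta, 0 < eta & forall t t' x x',
  0 <= t <= T -> 0 <= t' <= T -> `|x| <= M -> `|x'| <= M ->
  `|x - x'| <= eta -> `|t - t'| <= eta -> W t x <= W t' x' + e.
Proof.
move=> e0; have [d1 d10 H1] := free_value_delay M e0.
have [d2 d20 H2] := free_value_advance M e0.
exists (Num.min d1 d2); first by rewrite lt_min d10.
move=> t t' x x' /andP[t0 tT] /andP[t'0 t'T] xM x'M.
rewrite !le_min => /andP[xd1 xd2] /andP[td1 td2].
have [tt'|/ltW t't] := leP t t'.
  by apply: H2 => //; rewrite (le_trans _ td2)// distrC ler_norm.
apply: H1 => //; first by rewrite distrC.
by rewrite (le_trans _ td1)// ler_norm.
Qed.

Lemma free_value_dpp_impulse t x xi : 0 <= t <= T -> K xi ->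
  W t x <= ell t x xi + W t (x + xi).
Proof.
move=> /andP[t0 tT] Kxi; rewrite -lerBlDl; apply: free_value_ge => c cc; rewrite lerBlDl.
have := @free_value_le t x ((t, xi) :: c) t0.
by rewrite total_cons/= (flow_id C0)// gcost_id add0r lexx tT; apply.
Qed.

(** Dynamic programming for a single control, according to whether its first impulse comes before
    [s]. If it does, the running cost before it is dropped and the tail is bounded below by the
    value. *)
Lemma total_dpp t s x c : 0 <= t -> t <= s -> s <= T -> ctrl t c ->
  gcost t x s + W s (Phi t x s) <= total t x c \/
  exists r xi, [/\ t <= r <= s, K xi &
    ell r (Phi t x r) xi + W r (Phi t x r + xi) <= total t x c].
Proof.
move=> t0 ts sT cc.
have H : ctrl s c -> gcost t x s + W s (Phi t x s) <= total t x c.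
  by move=> cs; rewrite (total_split x ts sT cs) lerD2l free_value_le// (le_trans t0).
case: c cc H => [|p c] /= cc H; first by left; apply: H.
case: cc => /andP[tp pT] Kp cp.
have [sp|ps] := leP s p.1; first by left; apply: H; rewrite sp pT.
right; exists p.1, p.2; split => //; first by rewrite tp ltW.
rewrite total_cons -[leLHS]add0r lerD ?gcost_ge0// lerD2l free_value_le//.
exact: le_trans tp.
Qed.

(** At time T the flow does not move, and the hypothesis on [k] removes the impulses one at a
    time. *)
Lemma free_value_terminal x : (forall y xi, K xi -> k y <= ell T y xi + k (y + xi)) ->
  W T x = k x.
Proof.
move=> kell; apply/eqP; rewrite eq_le; apply/andP; split.
  have := @free_value_le T x [::] (ltW T0) I.
  by rewrite total_nil gcost_id (flow_id C0)// add0r.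
apply: free_value_ge => c; elim: c x => [|p c ih] x /=.
  by rewrite total_nil gcost_id (flow_id C0)// add0r.
move=> [Tp Kp cp]; have pE : p.1 = T by apply/eqP; rewrite eq_le andbC.
rewrite total_cons pE gcost_id (flow_id C0)// add0r (le_trans (kell x _ Kp))//.
by rewrite lerD2l ih// -pE.
Qed.

(** * Continuity of the value and the intervention operator N *)

Variable Lt : R.
Hypotheses (K_closed : closed K) (K0 : K 0) (Lt_ge0 : 0 <= Lt)
  (ell_cont : forall t x, 0 <= t <= T -> {within K, continuous (ell t x)})
  (ell_time : forall s t x xi, 0 <= s -> s <= t -> t <= T -> K xi ->
     ell s x xi <= ell t x xi + Lt * (t - s)).

Lemma free_value_unif_norm M e : 0 < e -> exists2 eta, 0 < eta & forall t t' x x',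
  0 <= t <= T -> 0 <= t' <= T -> `|x| <= M -> `|x'| <= M ->
  `|x - x'| <= eta -> `|t - t'| <= eta -> `|W t x - W t' x'| <= e.
Proof.
move=> e0; have [d d0 Hd] := free_value_unif M e0.
exists d => // t t' x x' t0 t'0 xM x'M xd td.
have := Hd t t' x x' t0 t'0 xM x'M xd td.
have := Hd t' t x' x t'0 t0 x'M xM; rewrite distrC => /(_ xd); rewrite distrC => /(_ td).
by rewrite ler_norml; lra.
Qed.

Lemma free_value_continuous_slab : continuous_slab T W.
Proof.
apply/subspace_continuousP => -[t x]; rewrite /slab/= in_itv/= => t0T.
apply/cvgrPdist_le => e e0.
have [d d0 Hd] := free_value_unif_norm (`|x| + 1) e0.
pose d' := Num.min d 1; have d'0 : 0 < d' by rewrite lt_min d0 ltr01.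
apply/nbhs_ballP; exists d' => // -[s y] [/= ts xy]; rewrite in_itv/= => s0T.
move: ts xy; rewrite -!ball_normE/= !lt_min => /andP[/ltW ts _] /andP[/ltW xy /ltW xy1].
apply: Hd => //; first by rewrite lerDl.
by rewrite -(subrK x y) addrC (le_trans (ler_normD _ _))// lerD2l distrC.
Qed.

Lemma free_value_continuous t : 0 <= t <= T -> continuous (W t).
Proof.
move=> t0T x; apply/(@cvgrPdist_le _ _ _ (nbhs x)) => e e0.
have [d d0 Hd] := free_value_unif_norm (`|x| + 1) e0.
pose d' := Num.min d 1; have d'0 : 0 < d' by rewrite lt_min d0 ltr01.
apply/nbhs_ballP; exists d' => // y.
rewrite -!ball_normE/= !lt_min => /andP[/ltW xy /ltW xy1].
apply: Hd => //; [by rewrite lerDl| |by rewrite subrr normr0 ltW].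
by rewrite -(subrK x y) addrC (le_trans (ler_normD _ _))// lerD2l distrC.
Qed.

Lemma is_N_free_value t x : 0 <= t <= T -> exists m, is_N K ell W t x m.
Proof.
move=> t0T; have /andP[t0 tT] := t0T.
have [|z|B|z Kz zmin] := @coercive_min R n K (fun z => W t (x + z) + ell t x z) _ K_closed.
- by exists 0.
- apply: cvgD; last exact: ell_cont.
  have : continuous (fun z => W t (x + z)).
    move=> w; apply: (@continuous_comp _ _ _ (fun z => x + z) (W t)).
      exact: continuous_addl.
    exact: free_value_continuous.
  by move/continuous_subspaceT; exact.
- have [M HM] := ell_coercive B; exists M => z Kz zB; apply: (HM t x) => //.
  by rewrite (le_trans _ zB)// lerDr free_value_ge0.
exists (W t (x + z) + ell t x z); split; first by exists z.
by move=> _ [z' Kz' <-]; exact: zmin.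
Qed.

Lemma free_value_le_N t x m : 0 <= t <= T -> is_N K ell W t x m -> W t x <= m.
Proof.
by move=> t0T [[z Kz <-] _]; rewrite addrC; exact: free_value_dpp_impulse.
Qed.

(** Lower semicontinuity of N[W] forward in time, uniform in the impulse: either [ell] alone already
    reaches [m], or coercivity bounds [z] and W is uniformly continuous on the resulting ball. *)
Lemma is_N_lower t x m e : 0 <= t -> is_N K ell W t x m -> 0 < e ->
  exists2 eta, 0 < eta & forall r y z, t <= r <= T -> r - t <= eta -> `|x - y| <= eta ->
    K z -> m - e <= ell r y z + W r (y + z).
Proof.
move=> t0 [_ Nm] e0; have e3 : 0 < e / 3 by rewrite divr_gt0.
have [A HA] := ell_coercive m.
have [d1 d10 H1] := ell_unif (`|x| + 1) e3.
have [d2 d20 H2] := free_value_unif (`|x| + 1 + `|A|) e3.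
have Lt0 := Lt_ge0; have L1 : 0 < 3 * (Lt + 1) by lra.
(* The last entry keeps the time variation Lt (r - t) of [ell] below e / 3; the + 1 avoids dividing
   by zero when Lt = 0. *)
pose d := Num.min (Num.min d1 d2) (Num.min 1 (e / (3 * (Lt + 1)))).
exists d; first by rewrite !lt_min d10 d20 ltr01 divr_gt0.
move=> r y z /andP[tr rT]; rewrite !le_min => /andP[/andP[rd1 rd2] /andP[r1 re]].
move=> /andP[/andP[yd1 yd2] /andP[y1 ye]] Kz.
have r0 := le_trans t0 tr; have tT := le_trans tr rT.
have [mell|ellm] := leP m (ell r y z).
  by have := free_value_ge0 (y + z) r0; lra.
have zA : `|z| <= `|A|.
  by rewrite (le_trans _ (ler_norm _))// (HA r y)// ?r0//; exact: ltW.
have xM : `|x| <= `|x| + 1 by rewrite lerDl.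
have yM : `|y| <= `|x| + 1.
  by rewrite -(subrK x y) addrC (le_trans (ler_normD _ _))// lerD2l distrC.
have a1 := H1 t x y z ltac:(by rewrite t0) Kz xM yM yd1.
have a2 := ell_time y t0 tr rT Kz.
have a3 : W t (x + z) <= W r (y + z) + e / 3.
  apply: H2; rewrite ?t0 ?r0 ?rT//.
  - by rewrite (le_trans (ler_normD _ _)) ?lerD.
  - by rewrite (le_trans (ler_normD _ _)) ?lerD.
  - by rewrite opprD addrACA subrr addr0.
  - by rewrite distrC ger0_norm ?subr_ge0.
have a4 : Lt * (r - t) <= e / 3.
  move: re; rewrite ler_pdivlMr// => re.
  have : 0 <= r - t by rewrite subr_ge0.
  nra.
have := Nm (W t (x + z) + ell t x z) ltac:(by exists z).
lra.
Qed.

(** * Viscosity inequalities by expansion along the flow *)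

Section TestFunction.
Variables (phi dt : R -> 'rV[R]_n -> R) (dx : R -> 'rV[R]_n -> 'rV[R]_n).
Hypothesis C1 : C1_slab T phi dt dx.

(** The right derivative at s = t of [gcost t x s + phi s (Phi t x s)]; see [flow_expansion]. *)
Definition flow_generator t x := dt t x + dotp (dx t x) (F t x) + g t x.
Local Notation HJ := flow_generator.

Lemma flow_expansion t x e : 0 <= t < T -> 0 < e ->
  exists2 eta, 0 < eta & forall s, t <= s <= T -> s - t <= eta ->
    `|gcost t x s + (phi s (Phi t x s) - phi t x) - (s - t) * HJ t x| <= e * (s - t).
Proof.
move=> t0T e0; have /andP[t0 tT] := t0T.
(* [q] collects the errors in units of e1 (s - t): two from the running cost and the time increment,
   one from the flow remainder tested against the gradient, one from the space increment. The last
   uses e1 <= 1 to bound the displacement by (|F t x| + 1) (s - t). *)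
pose q := 2 + n%:R * `|dx t x| + n%:R * (`|F t x| + 1).
have q2 : 2 <= q by rewrite /q -addrA lerDl addr_ge0 ?mulr_ge0 ?addr_ge0.
have q0 : 0 < q by apply: lt_le_trans q2.
pose e1 := Num.min 1 (e / q).
have e10 : 0 < e1 by rewrite lt_min ltr01 divr_gt0.
have e1q : e1 * q <= e by rewrite -ler_pdivlMr// ge_min lexx orbT.
have e11 : e1 <= 1 by rewrite ge_min lexx.
have [d1 d10 H1] := flow_right_derivative C0 cF lipF F0 t x e10.
have [d2 d20 H2] := C1_slab_increment C1 x t0T e10.
have cg0 := @gflow_continuous t x t.
have /cvgrPdist_le/(_ _ e10)/nbhs_ballP[d3 /= d30 H3] := cg0.
have f0 : 0 < `|F t x| + 1 by rewrite ltr_wpDl.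
exists (Num.min (Num.min d1 d2) (Num.min (d3 / 2) (d2 / (`|F t x| + 1)))).
  by rewrite !lt_min d10 d20 !divr_gt0.
move=> s /andP[ts sT]; rewrite !le_min => /andP[/andP[sd1 sd2] /andP[sd3 sd4]].
have st0 : 0 <= s - t by rewrite subr_ge0.
have A1 := H1 s ltac:(by rewrite ts -lerBlDl).
have A2 : `|Phi t x s - x| <= (`|F t x| + 1) * (s - t).
  rewrite -(subrK ((s - t) *: F t x) (Phi t x s - x)) (le_trans (ler_normD _ _))//.
  rewrite addrC mulrDl mul1r lerD//; first by rewrite normrZ (ger0_norm st0) mulrC.
  by rewrite (le_trans A1)// ler_piMl.
have A3 := H2 s (Phi t x s) ltac:(by rewrite ts) sd2
   ltac:(by rewrite (le_trans A2)// mulrC -ler_pdivlMr).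
have A4 : `|gcost t x s - (s - t) * g t x| <= e1 * (s - t).
  rewrite mulrC -(Rintegral_cst_itv (g t x) ts) /gcost -RintegralB//; last 2 first.
  - by apply: continuous_integrable; exact: gflow_continuous.
  - by apply: continuous_integrable; exact: cst_continuous.
  apply: Rintegral_bound => //.
    apply: continuous_integrable => r; apply: cvgB; [exact: gflow_continuous|exact: cvg_cst].
  move=> r /andP[tr rs]; have := H3 r; rewrite (flow_id C0)// distrC; apply.
  rewrite -ball_normE/= ler0_norm; lra.
have A5 : `|dotp (dx t x) (Phi t x s - x - (s - t) *: F t x)| <= n%:R * `|dx t x| * (e1 * (s - t)).
  by rewrite (le_trans (dotp_bound _ _))// ler_wpM2l// mulr_ge0.
have A6 : e1 * ((s - t) + n%:R * `|Phi t x s - x|) <=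
   e1 * ((s - t) + n%:R * ((`|F t x| + 1) * (s - t))).
  by rewrite ler_wpM2l ?(ltW e10)// lerD2l ler_wpM2l.
have A7 : dotp (dx t x) (Phi t x s - x) =
   (s - t) * dotp (dx t x) (F t x) + dotp (dx t x) (Phi t x s - x - (s - t) *: F t x).
  by rewrite -dotpZr -dotpDr [_ *: _ + _]addrC subrK.
rewrite A7 in A3; rewrite /HJ.
have A8 : e1 * q * (s - t) <= e * (s - t) by rewrite ler_wpM2r.
apply: le_trans A8; rewrite /q.
set u := dotp _ (F t x) in A3 *; set v := dotp _ _ in A3 A5.
move: A3 A4 A5 A6; set P1 := phi s _; set P2 := phi t x; set G := gcost _ _ _.
set a := n%:R * `|dx t x|; set b := `|F t x| + 1; set w := `|Phi t x s - x|.
move=> A3 A4 A5 A6.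
have -> : G + (P1 - P2) - (s - t) * (dt t x + u + g t x) =
  (P1 - P2 - (dt t x * (s - t) + ((s - t) * u + v))) + (G - (s - t) * g t x) + v by ring.
rewrite (le_trans (ler_normD _ _))//.
have -> : e1 * (2 + a + n%:R * b) * (s - t) =
   e1 * (s - t + n%:R * (b * (s - t))) + e1 * (s - t) + a * (e1 * (s - t)) by ring.
rewrite lerD// (le_trans (ler_normD _ _))// lerD//.
exact: le_trans A6.
Qed.

(** If the generator were negative, letting the flow run for a short time would decrease running
    cost plus [phi]; by the local maximum it would decrease running cost plus value too, against
    [free_value_dpp_flow]. *)
Lemma free_value_subsolution t x : 0 <= t < T ->
  local_max_slab T (fun s y => W s y - phi s y) t x -> 0 <= HJ t x.
Proof.
move=> t0T /nbhs_ballP[d /= d0 Hd]; have /andP[t0 tT] := t0T.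
rewrite leNgt; apply/negP => H0.
(* An error rate of half the generator still leaves a strict decrease. *)
have e0 : 0 < - HJ t x / 2 by rewrite divr_gt0// oppr_gt0.
have [d1 d10 H1] := flow_expansion x t0T e0.
have := @flow_continuous _ _ _ _ C0 cF lipF F0 t x t.
rewrite /continuous_at (flow_id C0)// => /cvgrPdist_lt/(_ _ d0)/nbhs_ballP[d2 /= d20 H2].
pose s := t + Num.min (Num.min d1 (d / 2)) (Num.min (d2 / 2) (T - t)).
set mm := Num.min _ _ in s.
have mm0 : 0 < mm by rewrite /mm !lt_min d10 !divr_gt0//= subr_gt0.
have : mm <= mm by [].
rewrite {2}/mm !le_min => /andP[/andP[m1 m2] /andP[m3 m4]].
have st : s - t = mm by rewrite /s addrC addKr.
have tsT : t <= s <= T by rewrite /s lerDl ltW//=; lra.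
have /andP[ts sT] := tsT.
have := H1 s tsT; rewrite st => /(_ m1) A1.
have A2 := free_value_dpp_flow x t0 ts sT.
have A3 : W s (Phi t x s) - phi s (Phi t x s) <= W t x - phi t x.
  apply: (Hd (s, Phi t x s)) => /=; last by rewrite /slab/= in_itv/= sT (le_trans t0).
  split; rewrite -ball_normE/=.
    by rewrite distrC st ger0_norm ?(ltW mm0)//; lra.
  by apply: H2; rewrite -ball_normE/= distrC st ger0_norm ?(ltW mm0)//; lra.
move: A1; rewrite ler_norml => /andP[_ A1].
have : mm * HJ t x < 0 by rewrite pmulr_rlt0.
lra.
Qed.

(** If the generator were positive, take a control whose excess over the value is small compared
    with the elapsed time [mm]. Without an impulse before [s] it contradicts the expansion at the
    local minimum; with one it contradicts the strict gap below [m], by [is_N_lower]. *)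
Lemma free_value_supersolution t x m : 0 <= t < T -> is_N K ell W t x m -> W t x < m ->
  local_min_slab T (fun s y => W s y - phi s y) t x -> HJ t x <= 0.
Proof.
move=> t0T Nm Wm /nbhs_ballP[d /= d0 Hd]; have /andP[t0 tT] := t0T.
rewrite leNgt; apply/negP => H0.
have e0 : 0 < HJ t x / 4 by rewrite divr_gt0.
have gap : 0 < (m - W t x) / 2 by rewrite divr_gt0// subr_gt0.
have [d1 d10 H1] := flow_expansion x t0T e0.
have [d3 d30 H3] := is_N_lower t0 Nm gap.
have d'0 : 0 < Num.min d d3 by rewrite lt_min d0.
have := @flow_continuous _ _ _ _ C0 cF lipF F0 t x t.
rewrite /continuous_at (flow_id C0)// => /cvgrPdist_lt/(_ _ d'0)/nbhs_ballP[d2 /= d20 H2].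
(* With [mm] below this quotient, the excess HJ mm / 4 is at most a quarter of m - W, whereas an
   early impulse loses at least half of it. *)
have q0 : 0 < (m - W t x) / (HJ t x) by rewrite divr_gt0// subr_gt0.
pose mm := Num.min (Num.min (Num.min d1 d3) (d / 2))
   (Num.min (Num.min (d2 / 2) (T - t)) ((m - W t x) / (HJ t x))).
have mm0 : 0 < mm by rewrite /mm !lt_min d10 d30 q0 subr_gt0 tT !divr_gt0.
have : mm <= mm by [].
rewrite {2}/mm !le_min => /andP[/andP[/andP[m1 m5] m2] /andP[/andP[m3 m4] m6]].
move: m6; rewrite ler_pdivlMr// => m6.
move: mm => mm in mm0 m1 m2 m3 m4 m5 m6 *.
pose s := t + mm.
have st : s - t = mm by rewrite /s addrC addKr.
have tsT : t <= s <= T by rewrite /s lerDl (ltW mm0)//=; lra.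
have /andP[ts sT] := tsT.
have near_x r : t <= r <= s -> `|x - Phi t x r| < Num.min d d3.
  by move=> /andP[tr rs]; apply: H2; rewrite -ball_normE/= ler0_norm; lra.
have := H1 s tsT; rewrite st => /(_ m1) A1.
have em : 0 < HJ t x / 4 * mm by rewrite mulr_gt0.
have [c cc ce] := free_value_approx x t0 em.
have [A2|[r [z [trs Kz A2]]]] := total_dpp x t0 ts sT cc.
- have A3 : W t x - phi t x <= W s (Phi t x s) - phi s (Phi t x s).
    apply: (Hd (s, Phi t x s)) => /=; last by rewrite /slab/= in_itv/= sT (le_trans t0).
    split; rewrite -ball_normE/=.
      by rewrite distrC st ger0_norm ?(ltW mm0)//; lra.
    by have := near_x s; rewrite ts lexx lt_min => /(_ isT) /andP[].
  move: A1; rewrite ler_norml => /andP[A1 _].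
  have : 0 < mm * HJ t x by rewrite mulr_gt0.
  lra.
- have /andP[tr rs] := trs.
  have := H3 r (Phi t x r) z ltac:(by rewrite tr (le_trans rs)) ltac:(lra).
  have := near_x r trs; rewrite lt_min => /andP[_ /ltW nx] /(_ nx Kz).
  lra.
Qed.

End TestFunction.

End Controlled.

(** * States and costs of controls *)
Section Clamp.
Variables (R : realType) (T : R).
Hypothesis T0 : 0 < T.

Definition clamp (a b r : R) := Num.max a (Num.min b r).

Lemma clamp_itv a b r : a <= b -> a <= clamp a b r <= b.
Proof. by move=> ab; rewrite /clamp le_max lexx/= ge_max ab ge_min lexx. Qed.

Lemma clamp_id a b r : a <= r <= b -> clamp a b r = r.
Proof. by move=> /andP[ar rb]; rewrite /clamp min_r// max_r. Qed.

Lemma clamp_lip a b r s : `|clamp a b r - clamp a b s| <= `|r - s|.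
Proof.
have maxl (c x y : R) : x <= y -> Num.max c y - Num.max c x <= y - x.
  by have [?|?] := leP c x; have [?|?] := leP c y; lra.
have minl (c x y : R) : x <= y -> Num.min c y - Num.min c x <= y - x.
  by have [?|?] := leP c x; have [?|?] := leP c y; lra.
wlog rs : r s / r <= s => [H|].
  by have [/H//|/ltW/H] := leP r s; rewrite distrC [X in _ <= X]distrC.
have mrs : Num.min b r <= Num.min b s by rewrite le_min ge_min lexx ge_min rs orbT.
rewrite distrC [leRHS]distrC !ger0_norm ?subr_ge0 ?le_max2//.
by rewrite (le_trans (maxl _ _ _ mrs))// minl.
Qed.

Lemma within_clamp (u : R -> R) a b : a <= b -> {within `[a, b], continuous u} ->
  continuous (fun s => u (clamp a b s)).
Proof.
move=> ab /subspace_continuousP cu s; apply/cvgrPdist_le => e e0.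
have := cu (clamp a b s); rewrite /= in_itv/= clamp_itv// => /(_ isT).
move=> /cvgrPdist_le/(_ _ e0)/nbhs_ballP[d /= d0 Hd].
apply/nbhs_ballP; exists d => // r /= sr.
apply: Hd; last by rewrite in_itv/= clamp_itv.
by rewrite -ball_normE/= (le_lt_trans (clamp_lip _ _ _ _)).
Qed.

(** Freezing time outside [0, T] turns continuity relative to the slab into continuity on the whole
    space, as the construction of [flow] demands. *)
Lemma continuous_slab_clamp n (U : normedModType R) (G : R -> 'rV[R]_n -> U) :
  continuous_slab T G -> continuous (fun p : R * 'rV[R]_n => G (clamp 0 T p.1) p.2).
Proof.
move=> cG [t x]; apply/(@cvgrPdist_le _ _ _ (nbhs (t, x))) => e e0.
have [d d0 Hd] := @continuous_slab_dist R n T U G (clamp 0 T t) x e cG (clamp_itv _ (ltW T0)) e0.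
apply/nbhs_ballP; exists d => // -[s y] [/= st xy].
move: st xy; rewrite -!ball_normE/= => /ltW st /ltW xy.
rewrite distrC; apply: Hd; first exact: clamp_itv (ltW T0).
  by rewrite (le_trans (clamp_lip _ _ _ _))// distrC.
by rewrite distrC.
Qed.

End Clamp.

Lemma integrable_setU d (U : measurableType d) (R : realType)
    (mu : {measure set U -> \bar R}) (A B : set U) (u : U -> \bar R) :
  measurable A -> measurable B -> [disjoint A & B] ->
  mu.-integrable A u -> mu.-integrable B u -> mu.-integrable (A `|` B) u.
Proof.
move=> mA mB AB iA iB; have [muA fA] := integrableP _ _ _ iA.
have [muB fB] := integrableP _ _ _ iB; apply/integrableP.
split; first exact: (iffRL (measurable_funU _ mA mB)).
rewrite ge0_integral_setU//; first exact: lte_add_pinfty.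
have mabs := measurable_int mu (integrable_abse _).
by apply: (iffRL (measurable_funU _ mA mB)); split; exact: mabs.
Qed.

(** * Integrals of functions that are continuous up to a jump *)

Section Gluing.
Variable R : realType.
Let mu := @lebesgue_measure R.

Lemma itv_split (a b c : R) : a <= b -> b <= c ->
  `[a, c]%classic = `[a, b[%classic `|` `[b, c]%classic.
Proof. by move=> ab bc; rewrite -itv_bndbnd_setU ?bnd_simp. Qed.

Lemma disj_itv_split (a b c : R) : [disjoint `[a, b[%classic & `[b, c]%classic].
Proof.
by apply/disj_setPS => r [/=]; rewrite !in_itv/= => /andP[_ rb] /andP[]; rewrite leNgt rb.
Qed.

Lemma integrable_glue (u v : R -> R) a b c : a <= b -> b <= c ->
  continuous v -> (forall r, a <= r < b -> u r = v r) ->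
  mu.-integrable `[b, c] (EFin \o u) -> mu.-integrable `[a, c] (EFin \o u).
Proof.
move=> ab bc cv uv iu; rewrite (itv_split ab bc).
apply: integrable_setU => //; first exact: disj_itv_split.
apply: (@eq_integrable _ _ _ mu `[a, b[%classic _ (EFin \o v)) => //.
  by move=> r /set_mem/=; rewrite in_itv/= => /uv ->.
apply: integrableS (continuous_integrable a b cv) => //.
by apply: subset_itvl; rewrite bnd_simp.
Qed.

(** The right endpoint is left out because a right-continuous state has already jumped there. *)
Lemma Rintegral_eq_open (u v : R -> R) a b :
  mu.-integrable `[a, b] (EFin \o u) -> mu.-integrable `[a, b] (EFin \o v) ->
  (forall r, a <= r < b -> u r = v r) ->
  \int[mu]_(r in `[a, b]) u r = \int[mu]_(r in `[a, b]) v r.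
Proof.
move=> iu iv uv.
have sub : `[a, b[%classic `<=` `[a, b]%classic by apply: subset_itvl; rewrite bnd_simp.
rewrite -!Rintegral_itv_bndo_bndc; [|by apply: integrableS iv|by apply: integrableS iu].
by apply: eq_Rintegral => r /set_mem/=; rewrite in_itv/= => /uv ->.
Qed.

End Gluing.

(** * Any state of a control is a concatenation of flow pieces *)

Section Bridge.
Variables (R : realType) (n : nat) (T C : R) (f : R -> 'rV[R]_n -> 'rV[R]_n)
  (g : R -> 'rV[R]_n -> R) (K : set 'rV[R]_n) (ell : R -> 'rV[R]_n -> 'rV[R]_n -> R)
  (h : 'rV[R]_n -> R).
Let F t x := f (clamp 0 T t) x.
Let G t x := g (clamp 0 T t) x.
Hypotheses (C0 : 0 < C)
  (cF : continuous (fun p : R * 'rV[R]_n => F p.1 p.2))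
  (lipF : forall t x y, `|F t x - F t y| <= C * `|x - y|)
  (F0 : forall t, `|F t 0| <= C)
  (cG : continuous (fun p : R * 'rV[R]_n => G p.1 p.2)).
Implicit Types (t s : R) (x : 'rV[R]_n) (c : seq (R * 'rV[R]_n)) (X : R -> 'rV[R]_n).
Local Notation mu := (@lebesgue_measure R).
Local Notation Phi := (flow F).

Lemma field_clamp r : 0 <= r <= T -> f r = F r.
Proof. by move=> r0T; rewrite /F clamp_id. Qed.

Lemma cost_clamp r : 0 <= r <= T -> g r = G r.
Proof. by move=> r0T; rewrite /G clamp_id. Qed.

Lemma ctrlP t c : ctrl T K t c <-> impulse_control T K t c.
Proof.
elim: c t => [|p c ih] t /=; first by split.
split=> [[tp Kp /ih[sc tc Kc]]|[sc tc Kc]]; last first.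
  have sc' := order_path_min le_trans sc.
  split; [by apply: tc; rewrite mem_head|by apply: Kc; rewrite mem_head|].
  apply/ih; split; first exact: path_sorted sc.
    move=> q qc; have /andP[_ ->] := tc q ltac:(by rewrite in_cons qc orbT).
    by rewrite andbT; exact: (allP sc' _ (map_f fst qc)).
  by move=> q qc; apply: Kc; rewrite in_cons qc orbT.
have /andP[tp1 pT] := tp.
split.
- rewrite /= path_min_sorted//; apply/allP => _ /mapP[q qc ->].
  by have /andP[] := tc _ qc.
- move=> q; rewrite in_cons => /predU1P[->//|qc].
  by have /andP[pq ->] := tc _ qc; rewrite (le_trans tp1).
- by move=> q; rewrite in_cons => /predU1P[->|/Kc].
Qed.

Lemma ctrl_impulse_sum0 t s c : s < t -> ctrl T K t c -> impulse_sum c s = 0.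
Proof.
move=> st /ctrlP[_ tc _]; rewrite /impulse_sum big_seq_cond big1// => p /andP[pc ps].
by have /andP[tp _] := tc _ pc; have := le_lt_trans (le_trans tp ps) st; rewrite ltxx.
Qed.

Lemma is_stateE t x c X s : is_state T f t x c X -> t <= s <= T ->
  X s = x + vint t s (fun r => f r (X r)) + impulse_sum c s.
Proof. by move=> [_ H] tsT; apply: H; rewrite in_itv. Qed.

(** [X] may jump at [u], so uniqueness is applied to its impulse-free part [Y], which is continuous,
    agrees with [X] before [u] and solves the flow equation up to [u]. The second conclusion is the
    state just before the impulses made at [u]. *)
Lemma state_prefix t u x c X : 0 <= t -> t <= u -> u <= T ->
  is_state T f t x c X -> ctrl T K u c ->
  (forall s, t <= s < u -> X s = Phi t x s) /\
  x + vint t u (fun r => f r (X r)) = Phi t x u.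
Proof.
move=> t0 tu uT HX cc; have [iX _] := HX.
have iXu : vintegrable t u (fun r => f r (X r)) by move=> i; exact: integrable_subitv (iX i).
(* Clamping makes [Y] continuous on the whole line, as [flow_unique] requires, although the
   integrand is only known to be integrable on [t, T]. *)
pose Y s := x + vint t (clamp t u s) (fun r => f r (X r)).
have cY : continuous Y.
  move=> s; apply: cvgD; first exact: cvg_cst.
  move: s; apply: continuous_rV => i.
  rewrite (_ : (fun r => _) = fun s =>
    parameterized_integral mu t (clamp t u s) (fun r => f r (X r) 0 i)).
    apply: (@within_clamp R (fun s => parameterized_integral mu t s (fun r => f r (X r) 0 i))) => //.
    exact: parameterized_integral_continuous.
  by apply/funext => s; rewrite mxE.
have YX s : t <= s < u -> Y s = X s.
  move=> /andP[ts su]; rewrite /Y clamp_id ?ts ?ltW// (is_stateE HX) ?ts ?(le_trans (ltW su))//.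
  by rewrite (ctrl_impulse_sum0 su cc) addr0.
have Yeq s : t <= s <= u -> Y s = x + vint t s (fun r => F r (Y r)).
  move=> /[dup] tsu /andP[ts su]; rewrite /Y clamp_id//; congr (_ + _).
  apply/rowP => i; rewrite !mxE; apply: Rintegral_eq_open.
  - exact: integrable_subitv (iXu i).
  - apply: continuous_integrable.
    have := @continuous_coord R n (fun r => F r (Y r)) i; apply.
    exact: continuous_along.
  - move=> r /andP[tr rs]; rewrite field_clamp; last first.
      by rewrite (le_trans t0 tr) (le_trans (ltW rs))// (le_trans su).
    by rewrite -/(Y r) YX// tr (lt_le_trans rs).
have YPhi := flow_unique C0 cF lipF F0 cY Yeq.
split=> [s tsu|].
  by rewrite -YX// YPhi//; move/andP: tsu => [-> /ltW ->].
by rewrite -YPhi ?tu ?lexx// /Y clamp_id ?tu ?lexx.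
Qed.

Lemma state_nil t x X : 0 <= t -> t <= T -> is_state T f t x [::] X ->
  forall s, t <= s <= T -> X s = Phi t x s.
Proof.
move=> t0 tT HX; have [H1 H2] := state_prefix t0 tT (lexx T) HX I.
move=> s /andP[ts]; rewrite le_eqVlt => /predU1P[->|sT]; last by apply: H1; rewrite ts.
by rewrite (is_stateE HX) ?tT ?lexx// H2 /impulse_sum big_nil addr0.
Qed.

Lemma impulse_sum_cons p c s : p.1 <= s -> impulse_sum (p :: c) s = p.2 + impulse_sum c s.
Proof. by move=> ps; rewrite /impulse_sum big_cons ps. Qed.

Lemma state_tail t x p c X : 0 <= t -> ctrl T K t (p :: c) ->
  is_state T f t x (p :: c) X -> is_state T f p.1 (Phi t x p.1 + p.2) c X.
Proof.
move=> t0 /= [/andP[tp pT] Kp cc] HX; have [iX _] := HX.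
have cp : ctrl T K p.1 (p :: c) by rewrite /= lexx pT.
have [_ H2] := state_prefix t0 tp pT HX cp.
split; first by move=> i; exact: integrable_subitv (iX i).
move=> s; rewrite in_itv/= => /andP[ps sT].
rewrite (is_stateE HX) ?sT ?(le_trans tp)// impulse_sum_cons// addrA.
rewrite (vint_chasles tp ps); last by move=> i; exact: integrable_subitv (iX i).
by rewrite addrA H2 -!addrA; congr (_ + _); rewrite addrCA.
Qed.

(** The strict test gives right-continuity: at an impulse time that impulse and all simultaneous
    ones have been applied. *)
Fixpoint trajectory t x c s : 'rV[R]_n :=
  if c is p :: c' then
    if s < p.1 then Phi t x s else trajectory p.1 (Phi t x p.1 + p.2) c' s
  else Phi t x s.

Lemma flow_field_continuous t x : continuous (fun r => F r (Phi t x r)).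
Proof. by apply: continuous_along => //; exact: (flow_continuous C0). Qed.

(** Existence of a state for every control: a flow piece is put in front of the trajectory of the
    tail. *)
Lemma trajectory_is_state t x c : 0 <= t -> t <= T -> ctrl T K t c ->
  is_state T f t x c (trajectory t x c).
Proof.
elim: c t x => [|p c ih] t x t0 tT /=.
  move=> _; have E s i : s <= T -> {in `[t, s]%classic,
      (fun r => f r (Phi t x r) 0 i) =1 (fun r => F r (Phi t x r) 0 i)}.
    move=> sT r /set_mem/=; rewrite in_itv/= => /andP[tr rs].
    by rewrite field_clamp// (le_trans t0 tr) (le_trans rs).
  split.
    move=> i; apply: (@eq_integrable _ _ _ mu _ _ (EFin \o (fun r => F r (Phi t x r) 0 i))) => //.
      by move=> r rT /=; rewrite (E T i (lexx _) r rT).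
    apply: continuous_integrable; have := @continuous_coord R n _ i (@flow_field_continuous t x); exact.
  move=> s; rewrite in_itv/= => /andP[ts sT].
  rewrite /impulse_sum big_nil addr0 {1}(flow_eq C0)//; congr (_ + _).
  by apply/rowP => i; rewrite !mxE; apply/esym/eq_Rintegral => r; apply: E.
move=> [/andP[tp pT] Kp cc].
have p0 := le_trans t0 tp.
have [iX HX] := ih p.1 (Phi t x p.1 + p.2) p0 pT cc.
set X := trajectory _ _ _ in iX HX.
set Y := fun s => _.
have YX s : p.1 <= s -> Y s = X s by move=> ps; rewrite /Y ltNge ps.
have YPhi s : s < p.1 -> Y s = Phi t x s by move=> sp; rewrite /Y sp.
have iY1 : vintegrable p.1 T (fun r => f r (Y r)).
  move=> i; apply: (@eq_integrable _ _ _ mu _ _ (EFin \o (fun r => f r (X r) 0 i))) => //.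
    by move=> r /set_mem/=; rewrite in_itv/= => /andP[pr _]; rewrite YX.
  exact: iX.
have fPhi r i : t <= r < p.1 -> f r (Y r) 0 i = F r (Phi t x r) 0 i.
  move=> /andP[tr rp]; rewrite YPhi// field_clamp// (le_trans t0 tr)//= (le_trans (ltW rp))//.
have iY : vintegrable t T (fun r => f r (Y r)).
  move=> i; apply: (integrable_glue tp pT (v := fun r => F r (Phi t x r) 0 i)) => //.
  - have := @continuous_coord R n _ i (@flow_field_continuous t x); exact.
  - by move=> r; exact: fPhi.
have vY s : t <= s <= p.1 -> vint t s (fun r => f r (Y r)) = vint t s (fun r => F r (Phi t x r)).
  move=> /andP[ts sp]; apply/rowP => i; rewrite !mxE; apply: Rintegral_eq_open.
  - by apply: integrable_subitv (iY i) => //; exact: le_trans pT.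
  - apply: continuous_integrable; have := @continuous_coord R n _ i (@flow_field_continuous t x); exact.
  - by move=> r /andP[tr rs]; apply: fPhi; rewrite tr (lt_le_trans rs).
split=> // s; rewrite in_itv/= => /andP[ts sT].
have [ps|sp] := leP p.1 s; last first.
  rewrite YPhi// (_ : \row_i _ = vint t s (fun r => f r (Y r)))// vY ?ts ?ltW//.
  rewrite (@ctrl_impulse_sum0 p.1 s (p :: c))//= ?lexx ?pT//.
  by rewrite addr0 -(flow_eq C0).
rewrite YX// HX ?in_itv/= ?ps// impulse_sum_cons//.
rewrite (_ : \row_i _ = vint p.1 s (fun r => f r (X r)))//.
rewrite [in RHS](_ : \row_i _ = vint t s (fun r => f r (Y r)))//.
rewrite (vint_chasles tp ps); last by move=> i; exact: integrable_subitv (iY i).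
rewrite vY ?tp ?lexx// [x + (_ + _)]addrA -(flow_eq C0)//.
rewrite (@eq_vint _ _ p.1 s (fun r => f r (Y r)) (fun r => f r (X r))); last first.
  by move=> r /andP[pr _]; rewrite YX.
by rewrite -!addrA; congr (_ + _); rewrite addrCA.
Qed.

Lemma state_left_limit t u x c X : 0 <= t -> t < u -> u <= T ->
  is_state T f t x c X -> ctrl T K u c -> lim (X s @[s --> u^'-]) = Phi t x u.
Proof.
move=> t0 tu uT HX cc; have [H _] := state_prefix t0 (ltW tu) uT HX cc.
apply/cvg_lim => //.
have cP : Phi t x s @[s --> u^'-] --> Phi t x u.
  by apply: cvg_at_left_filter; exact: (flow_continuous C0).
apply: cvg_trans cP; apply: near_eq_cvg; near=> s.
by rewrite H//; apply/andP; split; near: s; [exact: nbhs_left_ge|exact: nbhs_left_lt].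
Unshelve. all: by end_near. Qed.

(** The cost depends on the control alone and not on the chosen [X], which settles the quantifier
    over states in [value]. *)
Lemma state_running t x c X : 0 <= t -> t <= T -> ctrl T K t c ->
  is_state T f t x c X ->
  [/\ mu.-integrable `[t, T] (fun r => (g r (X r))%:E),
    X T = endpoint F T t x c &
    cost T g h ell t x c X = running F T G ell t x c + h (endpoint F T t x c)].
Proof.
elim: c t x => [|p c ih] t x t0 tT.
  move=> _ HX; have XP := state_nil t0 tT HX.
  have E : {in `[t, T]%classic, (fun r => g r (X r)) =1 (fun r => G r (Phi t x r))}.
    move=> r /set_mem/=; rewrite in_itv/= => /andP[tr rT].
    by rewrite XP ?tr// cost_clamp// rT (le_trans t0).
  split => /=.
  - apply: (@eq_integrable _ _ _ mu _ _ (EFin \o (fun r => G r (Phi t x r)))) => //.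
      by move=> r rT /=; rewrite E.
    apply: continuous_integrable; apply: continuous_along => //; exact: (flow_continuous C0).
  - by rewrite XP// tT lexx.
  - rewrite /cost big_ord0 addr0 XP ?tT ?lexx//; congr (_ + _).
    exact: eq_Rintegral.
move=> cc HX; have /= [/andP[tp pT] Kp cp] := cc.
have p0 := le_trans t0 tp.
have HX' := state_tail t0 cc HX.
have [ig XT costE] := ih p.1 (Phi t x p.1 + p.2) p0 pT cp HX'.
have cpp : ctrl T K p.1 (p :: c) by rewrite /= lexx pT.
have [XPhi _] := state_prefix t0 tp pT HX cpp.
have gE r : t <= r < p.1 -> g r (X r) = G r (Phi t x r).
  move=> /andP[tr rp]; rewrite XPhi ?tr// cost_clamp// (le_trans t0 tr)/=.
  exact: le_trans (ltW rp) pT.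
have cGP : continuous (fun r => G r (Phi t x r)).
  by apply: continuous_along => //; exact: (flow_continuous C0).
have igt : mu.-integrable `[t, T] (fun r => (g r (X r))%:E).
  exact: (@integrable_glue R (fun r => g r (X r)) (fun r => G r (Phi t x r)) t p.1 T).
split=> //.
have pre0 : pre_impulse_state t x (p :: c) X 0 = Phi t x p.1.
  rewrite /pre_impulse_state /= big_nil addr0; case: eqVneq => [->|pt].
    by rewrite (flow_id C0).
  by apply: (state_left_limit _ _ pT HX cpp) => //; rewrite lt_neqAle eq_sym pt.
(* If a later impulse is simultaneous with [p], the jump [p.2] passes from the sum of earlier
   impulses into the initial state of the tail; otherwise both sides use the same left limit. *)
have preS k : (k < size c)%N ->
    pre_impulse_state t x (p :: c) X k.+1 = pre_impulse_state p.1 (Phi t x p.1 + p.2) c X k.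
  move=> kc; rewrite /pre_impulse_state /=; set tau := (nth _ c k).1.
  have ptau : p.1 <= tau.
    have /ctrlP[_ tc _] := cp.
    by have /andP[] := tc _ (mem_nth (0, 0) kc).
  rewrite big_cons [p.1 == tau]eq_sym; have [taup|taup] := eqVneq tau p.1.
    rewrite addrA; congr (_ + _ + _).
    by move: pre0; rewrite /pre_impulse_state /= big_nil addr0 -taup.
  rewrite gt_eqF//; apply: le_lt_trans tp _.
  by rewrite lt_neqAle eq_sym taup.
rewrite /= -[RHS]addrA -costE /cost big_ord_recl /= pre0.
under eq_bigr => i _ do rewrite /bump/= add1n preS ?ltn_ord//.
rewrite (@Rintegral_chasles R (fun r => g r (X r)) t p.1 T)//.
rewrite (@Rintegral_eq_open R (fun r => g r (X r)) (fun r => G r (Phi t x r)) t p.1)//.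
- by rewrite -/(gcost F G t x p.1); ring.
- exact: integrable_subitv igt.
- exact: continuous_integrable.
Qed.

End Bridge.

(** * The quasi-variational inequality *)
Section NormComparison.
Variables (R : realType) (n : nat).
Implicit Types x y : 'rV[R]_n.

Lemma enorm_ge0 x : 0 <= enorm x.
Proof. exact: sqrtr_ge0. Qed.

Lemma norm_le_enorm x : `|x| <= enorm x.
Proof.
apply/rV_norm_leP; first exact: enorm_ge0.
move=> i; rewrite -sqrtr_sqr ler_wsqrtr// /dotp (bigD1 i)//= expr2 lerDl.
by rewrite sumr_ge0// => j _; rewrite -expr2 sqr_ge0.
Qed.

Lemma enorm_le_norm x : enorm x <= n%:R * `|x|.
Proof.
rewrite -[leRHS]ger0_norm ?mulr_ge0// -sqrtr_sqr ler_wsqrtr// /dotp.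
rewrite (le_trans (ler_sum _ (fun i _ => _ : _ <= `|x| ^+ 2)))//.
  by move=> i _; rewrite -expr2 -real_normK ?num_real// ler_sqr ?nnegrE// rV_coord_le.
rewrite sumr_const card_ord -[_ *+ n]mulr_natl exprMn ler_wpM2r ?exprn_ge0//.
by rewrite -natrX ler_nat; case: n => // k; rewrite expnS leq_pmulr// expn_gt0.
Qed.

Lemma powR_le (a b r : R) : 0 <= r -> 0 <= a -> a <= b -> a `^ r <= b `^ r.
Proof.
by move=> r0 a0 ab; apply: ge0_ler_powR => //; rewrite nnegrE// (le_trans a0).
Qed.

Lemma holder_modulus (L mu delta M e : R) : (0 < n)%N -> 0 < L -> 0 < mu -> 0 < delta ->
  0 < e -> exists2 eta, 0 < eta & forall x x',
    `|x| <= M -> `|x'| <= M -> `|x - x'| <= eta ->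
    L * (1 + Num.max (enorm x `^ mu) (enorm x' `^ mu)) * enorm (x - x') `^ delta <= e.
Proof.
move=> n0 L0 mu0 delta0 e0; have nR : 0 < n%:R :> R by rewrite ltr0n.
(* [A] bounds the growth factor on the ball, and [eta] is the solution of A (n eta)^delta = e. *)
pose A := L * (1 + (n%:R * `|M|) `^ mu).
have A0 : 0 < A by rewrite mulr_gt0// ltr_wpDr// powR_ge0.
have ea : 0 < e / A by rewrite divr_gt0.
have eaE : ((e / A) `^ delta^-1) `^ delta = e / A.
  by rewrite -powRrM mulVf ?lt0r_neq0// powRr1// ltW.
exists ((e / A) `^ delta^-1 / n%:R); first by rewrite divr_gt0// powR_gt0.
move=> x x' xM x'M; rewrite ler_pdivlMr// mulrC => xx'.
have H : enorm (x - x') `^ delta <= e / A.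
  rewrite -eaE; apply: powR_le; [exact: ltW|exact: enorm_ge0|].
  exact: le_trans (enorm_le_norm _) xx'.
have nM y : `|y| <= M -> enorm y `^ mu <= (n%:R * `|M|) `^ mu.
  move=> yM; apply: powR_le; [exact: ltW|exact: enorm_ge0|].
  rewrite (le_trans (enorm_le_norm _))// ler_wpM2l// (le_trans yM)//.
  exact: ler_norm.
have -> : e = A * (e / A) by rewrite mulrC divfK// lt0r_neq0.
apply: ler_pM => //.
- by rewrite mulr_ge0 ?(ltW L0)// addr_ge0// le_max powR_ge0.
- exact: powR_ge0.
- by rewrite ler_wpM2l ?(ltW L0)// lerD2l ge_max !nM.
Qed.

Lemma powR_coercive (beta a B : R) : 0 < beta -> 0 < a ->
  exists M, forall x, a * enorm x `^ beta <= B -> `|x| <= M.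
Proof.
move=> b0 a0; exists ((`|B| / a) `^ beta^-1) => x.
move=> /le_trans/(_ (ler_norm B)); rewrite mulrC -ler_pdivlMr// => H.
rewrite (le_trans (norm_le_enorm x))//.
have -> : enorm x = (enorm x `^ beta) `^ beta^-1.
  by rewrite -powRrM mulfV ?lt0r_neq0// powRr1// enorm_ge0.
by apply: powR_le => //; [rewrite invr_ge0 ltW|exact: powR_ge0].
Qed.

End NormComparison.

(** The sum is twice the midpoint. *)
Lemma convex_cone_add (R : realType) (n : nat) (K : set 'rV[R]_n) x y :
  closed_convex_cone K -> K x -> K y -> K (x + y).
Proof.
move=> [_ cvK _ coneK] Kx Ky.
have h0 : 0 <= 2^-1 :> R by [].
have h1 : 2^-1 <= 1 :> R by rewrite invf_le1// ler1n.
have Kxy := set_mem (cvK x y (Itv01 h0 h1) (mem_set Kx) (mem_set Ky)).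
have := coneK 2 _ ltac:(by []) Kxy.
rewrite (_ : 2 *: _ = x + y)//.
change (2 *: (2^-1 *: x + (1 - 2^-1) *: y) = x + y).
rewrite scalerDr !scalerA mulfV// scale1r; congr (_ + _).
by rewrite -[RHS]scale1r; congr (_ *: _); field.
Qed.

(** * Appending one impulse at time T *)

Section FinalImpulse.
Variables (R : realType) (n : nat) (F : R -> 'rV[R]_n -> 'rV[R]_n) (C T : R)
  (g : R -> 'rV[R]_n -> R) (K : set 'rV[R]_n) (ell : R -> 'rV[R]_n -> 'rV[R]_n -> R).
Hypotheses (C0 : 0 < C) (cF : continuous (fun p : R * 'rV[R]_n => F p.1 p.2))
  (lipF : forall t x y, `|F t x - F t y| <= C * `|x - y|)
  (F0 : forall t, `|F t 0| <= C).

Lemma ctrl_rcons t c z : t <= T -> ctrl T K t c -> K z -> ctrl T K t (rcons c (T, z)).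
Proof.
elim: c t => [|p c ih] t tT /=; first by rewrite tT lexx.
by move=> [/andP[tp pT] Kp cc] Kz; split; [rewrite tp| |exact: ih].
Qed.

Lemma endpoint_rcons t x c z :
  endpoint F T t x (rcons c (T, z)) = endpoint F T t x c + z.
Proof. by elim: c t x => [|p c ih] t x //=; rewrite (flow_id C0). Qed.

Lemma running_rcons t x c z :
  running F T g ell t x (rcons c (T, z)) =
  running F T g ell t x c + ell T (endpoint F T t x c) z.
Proof.
elim: c t x => [|p c ih] t x /=; first by rewrite gcost_id addr0.
by rewrite ih -!addrA.
Qed.

End FinalImpulse.

Theorem theorem4p5 (R : realType) (n : nat) (hn : (1 <= n)%N)
    (T : R) (hT : 0 < T) (K D : set 'rV[R]_n)
    (f : R -> 'rV[R]_n -> 'rV[R]_n) (g : R -> 'rV[R]_n -> R)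
    (h : 'rV[R]_n -> R) (ell : R -> 'rV[R]_n -> 'rV[R]_n -> R)
    (Lf L mu delta ell0 delta0 beta : R) (alpha0 alpha : R -> R)
    (* (1) *)
    (hK : closed_convex_cone K)
    (hDo : open D) (hDc : connected D) (hDconv : convex_set D)
    (hD0 : D !=set0) (hDT : D <> setT)
    (hKD : (bounded_set D /\ K = setT) \/
           (conic D /\ [set eta - xi | eta in D & xi in K] = setT))
    (* (2) *)
    (hLf : 0 < Lf) (hfc : continuous_slab T f)
    (hfL : forall (t : R) (x x' : 'rV[R]_n), t \in `[0, T] ->
       enorm (f t x - f t x') <= Lf * enorm (x - x'))
    (hf0 : forall (t : R), t \in `[0, T] -> enorm (f t 0) <= Lf)
    (* (3) *)
    (hL : 0 < L) (hmu : 0 < mu) (hdelta : 0 < delta <= 1)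
    (hgc : continuous_slab T g) (hhc : continuous h)
    (hgb : forall (t : R) (x : 'rV[R]_n), t \in `[0, T] ->
       0 <= g t x <= L * (1 + enorm x `^ (mu + delta)))
    (hhb : forall x, 0 <= h x <= L * (1 + enorm x `^ (mu + delta)))
    (hgL : forall (t : R) (x x' : 'rV[R]_n), t \in `[0, T] ->
       `|g t x - g t x'| <=
         L * (1 + Num.max (enorm x `^ mu) (enorm x' `^ mu))
           * enorm (x - x') `^ delta)
    (hhL : forall x x',
       `|h x - h x'| <=
         L * (1 + Num.max (enorm x `^ mu) (enorm x' `^ mu))
           * enorm (x - x') `^ delta)
    (* (4) *)
    (hell0 : 0 < ell0) (hdelta0 : 0 < delta0) (hbeta : 0 < beta <= 1)
    (ha0c : {within `[0, T], continuous alpha0})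
    (hac : {within `[0, T], continuous alpha})
    (ha0p : forall (t : R), t \in `[0, T] -> 0 < alpha0 t)
    (hap : forall (t : R), t \in `[0, T] -> 0 < alpha t)
    (ha0d : forall s t : R, s \in `[0, T] -> t \in `[0, T] -> s <= t ->
       alpha0 t <= alpha0 s)
    (had : forall s t : R, s \in `[0, T] -> t \in `[0, T] -> s <= t ->
       alpha t <= alpha s)
    (hellc : {within [set q : R * 'rV[R]_n * 'rV[R]_n |
                      q.1.1 \in `[0, T] /\ K q.2],
              continuous (fun q : R * 'rV[R]_n * 'rV[R]_n =>
                            ell q.1.1 q.1.2 q.2)})
    (hellp : forall (t : R) (x xi : 'rV[R]_n), t \in `[0, T] -> K xi -> 0 < ell t x xi)
    (hellb : forall (t : R) (x xi : 'rV[R]_n), t \in `[0, T] -> K xi ->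
       ell0 + alpha0 t * enorm xi `^ beta <= ell t x xi
         <= L + alpha t * enorm xi `^ beta)
    (hellx : forall (t : R) (x x' xi : 'rV[R]_n), t \in `[0, T] -> K xi ->
       `|ell t x xi - ell t x' xi| <=
         L * (1 + Num.max (enorm x `^ mu) (enorm x' `^ mu))
           * enorm (x - x') `^ delta)
    (hellsub : forall (t : R) (x xi xi' : 'rV[R]_n), t \in `[0, T] -> K xi -> K xi' ->
       Num.min (ell t x xi + ell t (x + xi) xi')
               (ell t x xi' + ell t (x + xi') xi)
         - ell t x (xi + xi') >= delta0)
    (hellt : forall (t t' : R) (x xi : 'rV[R]_n), t \in `[0, T] -> t' \in `[0, T] -> K xi ->
       t <= t' -> ell t x xi - L * `|t - t'| <= ell t' x xi <= ell t x xi)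
    (* (5) *)
    (hinf : forall x, ~ D x ->
       (ereal_inf [set ((h (x + xi) + ell T x xi)%R)%:E
                  | xi in [set xi | K xi /\ D (x + xi)%R]] < (h x)%:E)%E) :
  (forall (t : R) (x : 'rV[R]_n), t \in `[0, T] -> value T K D f g h ell t x \is a fin_num) /\
  viscosity_solution T K D f g h ell
    (fun t x => fine (value T K D f g h ell t x)).
Proof.
have nR : 1 <= n%:R :> R by rewrite ler1n.
have nR0 : 0 < n%:R :> R by rewrite ltr0n.
have cl t : clamp 0 T t \in `[0, T] by rewrite in_itv/= clamp_itv// ltW.
have inT t : 0 <= t <= T -> t \in `[0, T] by rewrite in_itv.
have [K_closed K_conv K0 K_cone] := hK.
have KD x y : K x -> K y -> K (x + y) by exact: convex_cone_add.
have D_reach x : exists2 z, K z & D (x + z).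
  case: hKD => [[_ KT]|[_ DK]].
    by have [y Dy] := hD0; exists (y - x); [rewrite KT|rewrite addrCA subrr addr0].
  have : [set eta - xi | eta in D & xi in K] x by rewrite DK.
  by move=> [y Dy [z Kz <-]]; exists z => //; rewrite subrK.
pose F t x := f (clamp 0 T t) x; pose G t x := g (clamp 0 T t) x.
(* The factor n comes from |x| <= [enorm x] <= n |x|. *)
pose C := Lf * n%:R; have C0 : 0 < C by rewrite mulr_gt0.
have cF : continuous (fun p : R * 'rV[R]_n => F p.1 p.2) by exact: continuous_slab_clamp.
have lipF t x y : `|F t x - F t y| <= C * `|x - y|.
  rewrite (le_trans (norm_le_enorm _))// (le_trans (hfL _ _ _ (cl t)))//.
  by rewrite -mulrA ler_wpM2l ?(ltW hLf)// enorm_le_norm.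
have F0 t : `|F t 0| <= C.
  rewrite (le_trans (norm_le_enorm _))// (le_trans (hf0 _ (cl t)))//.
  by rewrite /C ler_peMr// ltW.
have cG : continuous (fun p : R * 'rV[R]_n => G p.1 p.2).
  by apply: (@continuous_slab_clamp R T hT n R^o).
have G_ge0 t x : 0 <= G t x by have /andP[] := hgb _ x (cl t).
have [delta0' delta1] := andP hdelta.
have G_bnd M : exists B, forall t x, `|x| <= M -> G t x <= B.
  exists (L * (1 + (n%:R * M) `^ (mu + delta))) => t x xM.
  have /andP[_ /le_trans] := hgb _ x (cl t); apply.
  rewrite ler_wpM2l ?(ltW hL)// lerD2l; apply: powR_le; [by rewrite addr_ge0// ltW|exact: enorm_ge0|].
  by rewrite (le_trans (enorm_le_norm _))// ler_wpM2l.
have G_unif M e : 0 < e -> exists2 eta, 0 < eta & forall t x x',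
    `|x| <= M -> `|x'| <= M -> `|x - x'| <= eta -> `|G t x - G t x'| <= e.
  move=> e0; have [d d0 Hd] := @holder_modulus R n L mu delta M e hn hL hmu delta0' e0.
  by exists d => // t x x' xM x'M xd; rewrite (le_trans (hgL _ _ _ (cl t)))// Hd.
have ell_ge t x xi : 0 <= t <= T -> K xi -> ell0 <= ell t x xi.
  move=> /inT t0T Kxi; have /andP[/(le_trans _) -> //] := hellb _ x _ t0T Kxi.
  by rewrite lerDl mulr_ge0 ?powR_ge0// ltW// ha0p.
have TT : T \in `[0, T] by rewrite in_itv/= lexx ltW.
have ell_coercive B : exists M, forall t x xi,
    0 <= t <= T -> K xi -> ell t x xi <= B -> `|xi| <= M.
  have [b0 b1] := andP hbeta.
  (* [alpha0] decreases, so its value at T gives a coercivity constant valid at all times. *)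
  have [M HM] := @powR_coercive R n beta (alpha0 T) B b0 (ha0p _ TT).
  exists M => t x xi t0T Kxi eB; apply: HM; apply: le_trans eB.
  have /andP[/(le_trans _) -> //] := hellb _ x _ (inT _ t0T) Kxi.
  rewrite -[leLHS]add0r lerD ?(ltW hell0)// ler_wpM2r ?powR_ge0//.
  by apply: ha0d => //; have /andP[] := t0T.
have ell_unif M e : 0 < e -> exists2 eta, 0 < eta & forall t x x' xi,
    0 <= t <= T -> K xi -> `|x| <= M -> `|x'| <= M -> `|x - x'| <= eta ->
    ell t x xi <= ell t x' xi + e.
  move=> e0; have [d d0 Hd] := @holder_modulus R n L mu delta M e hn hL hmu delta0' e0.
  exists d => // t x x' xi t0T Kxi xM x'M xd; rewrite -lerBlDl (le_trans (ler_norm _))//.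
  by rewrite (le_trans (hellx _ _ _ _ (inT _ t0T) Kxi))// Hd.
have ell_decr s t x xi : 0 <= s -> s <= t -> t <= T -> K xi -> ell t x xi <= ell s x xi.
  move=> s0 st tT Kxi.
  by have /andP[] := hellt s t x xi (inT s ltac:(by rewrite s0 (le_trans st)))
    (inT t ltac:(by rewrite tT (le_trans s0))) Kxi st.
have ell_time s t x xi : 0 <= s -> s <= t -> t <= T -> K xi ->
    ell s x xi <= ell t x xi + L * (t - s).
  move=> s0 st tT Kxi.
  have /andP[] := hellt s t x xi (inT s ltac:(by rewrite s0 (le_trans st)))
    (inT t ltac:(by rewrite tT (le_trans s0))) Kxi st.
  by rewrite distrC ger0_norm ?subr_ge0// lerBlDr.
have ell_cont t x : 0 <= t <= T -> {within K, continuous (ell t x)}.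
  move=> t0T; apply/subspace_continuousP => z Kz; apply/cvgrPdist_le => e e0.
  have /subspace_continuousP/(_ (t, x, z)) := hellc.
  move=> /(_ (conj (inT _ t0T) Kz)) /cvgrPdist_le/(_ _ e0)/nbhs_ballP[d /= d0 Hd].
  apply/nbhs_ballP; exists d => // y zy Ky; apply: (Hd (t, x, y)) => /=.
    by split => //=; split; exact: ballxx.
  by split => //; exact: inT.
pose l := ell T.
have T0T : 0 <= T <= T by rewrite lexx ltW.
have l_ge0 x z : K z -> 0 <= l x z by move=> Kz; rewrite ltW// hellp.
have l_coercive B : exists M, forall x z, K z -> l x z <= B -> `|z| <= M.
  by have [M HM] := ell_coercive B; exists M => x z; exact: HM.
have l_unif M e : 0 < e -> exists2 eta, 0 < eta & forall x x' z, K z ->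
    `|x| <= M -> `|x'| <= M -> `|x - x'| <= eta -> l x z <= l x' z + e.
  by move=> e0; have [d d0 Hd] := ell_unif M e e0; exists d => // x x' z Kz; exact: Hd.
have l_cont x : {within K, continuous (l x)} by exact: ell_cont.
have l_sub x z z' : K z -> K z' -> l x (z + z') <= l x z + l (x + z) z'.
  move=> Kz Kz'; have := hellsub T x z z' TT Kz Kz'.
  have : Num.min (ell T x z + ell T (x + z) z') (ell T x z' + ell T (x + z') z) <=
     ell T x z + ell T (x + z) z' by rewrite ge_min lexx.
  by rewrite /l; have d0 := hdelta0; lra.
have h_ge0 x : 0 <= h x by have /andP[] := hhb x.
have h_improve x : ~ D x -> exists z, [/\ K z, D (x + z) & h (x + z) + l x z < h x].
  move=> /hinf /ereal_inf_lt[_ [z [Kz Dz] <-]]; rewrite lte_fin => H.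
  by exists z.
pose k := hD K D h l.
have k_ge0 : forall x, 0 <= k x by exact: hD_ge0.
have k_bnd : forall M, exists B, forall x, `|x| <= M -> k x <= B by exact: hD_bounded.
have k_unif : forall M e, 0 < e -> exists2 eta, 0 < eta & forall x x',
   `|x| <= M -> `|x'| <= M -> `|x - x'| <= eta -> k x <= k x' + e by exact: hD_unif.
pose W := free_value F T G K ell k.
have W_le t x c : 0 <= t -> ctrl T K t c -> W t x <= total F T G ell k t x c.
  by move=> t0 cc; exact: (@free_value_le R n F T G _ K ell ell0).
have W_approx t x e : 0 <= t -> 0 < e ->
    exists2 c, ctrl T K t c & total F T G ell k t x c <= W t x + e.
  by move=> t0 e0; exact: (@free_value_approx R n F T G _ K ell ell0).
have k_cases : forall x, (closure D x /\ k x = h x) \/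
    exists z, [/\ K z, closure D (x + z) & k x = h (x + z) + l x z] by exact: hD_cases.
have k_le x : closure D x -> k x <= h x by exact: hD_le.
have k_sub x z : K z -> k x <= l x z + k (x + z) by exact: hD_sub.
have value_le t x c : 0 <= t <= T -> ctrl T K t c -> closure D (endpoint F T t x c) ->
    (value T K D f g h ell t x <= (running F T G ell t x c + h (endpoint F T t x c))%:E)%E.
  move=> /andP[t0 tT] cc Dc.
  have sX : is_state T f t x c (trajectory T f t x c)
    by exact: (@trajectory_is_state R n T C f K C0 cF lipF F0 t x c t0 tT cc).
  have [_ XT costE] := @state_running R n T C f g K ell h C0 cF lipF F0 cG t x c _ t0 tT cc sX.
  apply: ereal_inf_lbound; exists c, (trajectory T f t x c); split => //.
  - exact/ctrlP.
  - by rewrite XT.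
  - by rewrite costE.
have valueE t x : 0 <= t <= T -> value T K D f g h ell t x = (W t x)%:E.
  move=> t0T; have /andP[t0 tT] := t0T; apply/eqP; rewrite eq_le; apply/andP; split.
    apply/lee_addgt0Pr => e e0; rewrite -EFinD.
    have [c cc] := W_approx t x e t0 e0; rewrite /total -lee_fin; apply: le_trans.
    (* Any control becomes admissible at cost exactly h^D: it stops in the closure of D, or the
       minimizing jump is appended at T. *)
    have [[Dc ->]|[z [Kz Dz ->]]] := k_cases (endpoint F T t x c); first exact: value_le.
    have cz := ctrl_rcons tT cc Kz.
    have eE := @endpoint_rcons R n F C T C0 cF lipF F0 t x c z.
    have := value_le t x _ t0T cz; rewrite eE => /(_ Dz).
    by rewrite running_rcons [h _ + _]addrC addrA.
  (* Conversely an admissible control ends in the closure of D, where h^D <= h. *)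
  apply: le_ereal_inf_tmp => _ [c [X [/ctrlP cc sX DX ->]]]; rewrite lee_fin.
  have [_ XT ->] := @state_running R n T C f g K ell h C0 cF lipF F0 cG t x c _ t0 tT cc sX.
  by rewrite (le_trans (W_le t x c t0 cc))// lerD2l k_le// -XT.
split=> [t x|]; first by rewrite in_itv => /valueE ->.
set V := fun t x => _.
(* The identification concerns times in [0, T] only, so continuity and the local extrema are
   transferred relative to the slab. *)
have VW t : 0 <= t <= T -> V t = W t by move=> t0T; apply/funext => x; rewrite /V valueE.
have cV : continuous_slab T V.
  have cW : continuous_slab T W.
    exact: (@free_value_continuous_slab R n F C T C0 hT cF lipF F0 G cG G_ge0 G_bnd G_unif K ell ell0).
  apply: subspace_eq_continuous cW => -[t x] /set_mem; rewrite /slab/= in_itv/= => t0T.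
  by change (W t x = V t x); rewrite VW.
have VT x : V T x = k x.
  rewrite VW//; apply: (@free_value_terminal R n F C T C0 hT cF lipF F0 G G_ge0 K ell ell0) => //.
have isk x : is_hD T K D ell h x (k x).
  have [z Kz [zE lb]] := best_jump_attained K_closed D_reach hhc h_ge0 l_coercive l_cont x.
  exists (best_jump K D h l x) => //; split => //.
  by exists z.
have exN t x : 0 <= t <= T -> exists m, is_N K ell V t x m.
  move=> t0T; rewrite /is_N VW//.
  exact: (@is_N_free_value R n F C T C0 hT cF lipF F0 G cG G_ge0 G_bnd G_unif K ell ell0).
have fGE t x dt dx : 0 <= t <= T ->
    dt t x + dotp (dx t x) (f t x) + g t x = flow_generator F G dt dx t x.
  by move=> t0T; rewrite /flow_generator /F /G clamp_id.
have in_oT t : t \in `[0, T[ -> 0 <= t < T by rewrite in_itv.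
split; split => //.
- by move=> x; exists (k x); rewrite ?VT.
- move=> phi dt dx C1 t x /in_oT t0T lmax.
  have t0T' : 0 <= t <= T by have /andP[-> /ltW] := t0T.
  have [m Nm] := exN t x t0T'; exists m => //.
  rewrite le_min fGE// subr_ge0 VW//; apply/andP; split.
    apply: (@free_value_subsolution R n F C T C0 cF lipF F0 G cG G_ge0 K ell ell0 hell0 ell_ge
      k k_ge0 phi dt dx C1) => //.
    move: lmax; rewrite /local_max_slab !near_withinE; apply: filterS => -[s y] /= H s0T; have := H s0T.
    have s0T' : 0 <= s <= T by move: s0T; rewrite /slab/= in_itv.
    by rewrite (VW s s0T') (VW t t0T').
  rewrite /is_N VW// in Nm.
  exact: (@free_value_le_N R n F C T C0 cF lipF F0 G G_ge0 K ell ell0).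
- by move=> x; exists (k x); rewrite ?VT.
- move=> phi dt dx C1 t x /in_oT t0T lmin.
  have t0T' : 0 <= t <= T by have /andP[-> /ltW] := t0T.
  have [m Nm] := exN t x t0T'; exists m => //.
  rewrite ge_min fGE// subr_le0 VW//; rewrite /is_N VW// in Nm.
  (* Where N[V] <= V the second entry of the minimum is already nonpositive; elsewhere the strict
     gap needed by [free_value_supersolution] is available. *)
  have [mW|Wm] := leP m (W t x); first by rewrite orbT.
  rewrite orbF.
  apply: (@free_value_supersolution R n F C T C0 hT cF lipF F0 G cG G_ge0 G_bnd G_unif K ell
    ell0 hell0 ell_ge ell_coercive ell_unif ell_decr k k_ge0 k_bnd k_unif L (ltW hL)
    ell_time phi dt dx C1 t x m) => //.
  move: lmin; rewrite /local_min_slab !near_withinE; apply: filterS => -[s y] /= H s0T; have := H s0T.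
  have s0T' : 0 <= s <= T by move: s0T; rewrite /slab/= in_itv.
  by rewrite (VW s s0T') (VW t t0T').
Qed.
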